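(* Let $a\geq 0$ and let $\{f_n, n\in\mathbb{N}\}\subset \mathcal{L}^+_a$ be a sequence that converges uniformly on compact subsets of $\mathbb{C}$ to a function $f\in\mathcal{A}_a$ which does not vanish identically. Then $\{f_n\}$ is a bounded subset of $\mathcal{A}_a$, it converges to $f$ in the topology of $\mathcal{A}_a$, and $f\in\mathcal{L}^+$.
   Context: Let $\mathcal{E}$ denote the set of all entire functions. For $b>0$ and $f\in\mathcal{E}$ put $\|f\|_b=\sup_{k\in\mathbb{N}_0} b^{-k}|f^{(k)}(0)|$. For $a\geq 0$ let $\mathcal{A}_a=\{f\in\mathcal{E}: \|f\|_b<\infty \ \forall b>a\}$ with the locally convex topology generated by the norms $\{\|\cdot\|_b: b>a\}$; a subset $B$ is bounded in $\mathcal{A}_a$ if $\sup_{f\in B}\|f\|_b<\infty$ for every $b>a$. The class $\mathcal{L}^+$ (Laguerre entire functions) consists of all entire functions of the form $f(z)=Cz^l e^{\alpha z}\prod_{j=1}^\infty(1+\beta_j z)$ with $C\in\mathbb{C}$, $l\in\mathbb{N}_0$, $\alpha\geq 0$, $\beta_j\geq\beta_{j+1}\geq 0$ and $\sum_j\beta_j<\infty$. Put $\mathcal{L}^+_a=\mathcal{L}^+\cap\mathcal{A}_a$. *)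

(* Defs.v *)
(* The complex plane is modelled as
   R[i] (real_closed's complex numbers over a realType R), viewed as a normed
   module over itself via ^o, so that [derivable f z 1] is complex
   differentiability and [derive1n k f 0] is the k-th complex derivative
   f^(k)(0). *)
From HB Require Import structures.
From mathcomp Require Import all_boot all_order all_algebra.
From mathcomp Require Import all_classical all_reals all_analysis.
From mathcomp Require Import complex.
Set Implicit Arguments. Unset Strict Implicit. Unset Printing Implicit Defensive.
Import Order.TTheory GRing.Theory Num.Theory.
Import numFieldNormedType.Exports.
Local Open Scope ring_scope.
Local Open Scope complex_scope.
Local Open Scope classical_set_scope.

Local Notation normc := ComplexField.Normc.normc.

Definition CC (R : realType) : Type := (R[i])^o.

Section Defs.
Variable R : realType.
Local Notation C := (CC R).

Definition entire (f : C -> C) : Prop := forall z : C, derivable f z 1.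

Definition normA (b : R) (f : C -> C) : \bar R :=
  ereal_sup (range (fun k : nat => ((b ^- k) * normc (derive1n k f 0 : R[i]))%:E)).

Definition A_space (a : R) (f : C -> C) : Prop :=
  entire f /\ forall b : R, a < b -> (normA b f < +oo)%E.

Definition bounded_in_A (a : R) (B : set (C -> C)) : Prop :=
  forall b : R, a < b -> exists M : R, forall g, B g -> (normA b g <= M%:E)%E.

Definition cvg_in_A (a : R) (u : nat -> C -> C) (f : C -> C) : Prop :=
  forall b : R, a < b -> normA b (fun z => u n z - f z) @[n --> \oo] --> 0%E.

Definition cexp (z : C) : C :=
  lim (series (fun k : nat => (z ^+ k / (k`!)%:R : C)) @ \oo).

Definition cvg_compact (u : nat -> C -> C) (f : C -> C) : Prop :=
  forall K : set C, compact K ->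
  forall e : R, 0 < e ->
  \forall n \near \oo, forall z, K z -> normc (u n z - f z : R[i]) < e.

(* Laguerre entire functions L^+:
   f(z) = c z^l e^{alpha z} prod_{j>=1} (1 + beta_j z), the infinite product
   being the limit of its partial products (indices shifted to start at 0). *)
Definition Laguerre (f : C -> C) : Prop :=
  exists (c : C) (l : nat) (alpha : R) (beta : nat -> R),
    [/\ 0 <= alpha,
        (forall j, beta j.+1 <= beta j),
        (forall j, 0 <= beta j),
        cvg (series beta @ \oo) &
        forall z : C,
          (fun N : nat => c * z ^+ l * cexp (alpha%:C * z)
                          * \prod_(j < N) (1 + (beta j)%:C * z))
            @ \oo --> f z].

Definition Laguerre_a (a : R) (f : C -> C) : Prop := Laguerre f /\ A_space a f.

End Defs.

(* Main.v *)
Require Import Defs.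
From HB Require Import structures.
From mathcomp Require Import all_boot all_order all_algebra.
From mathcomp Require Import all_classical all_reals all_analysis.
From mathcomp Require Import complex ring lra zify.
Import Order.TTheory GRing.Theory Num.Theory.
Import numFieldNormedType.Exports.
Set Implicit Arguments. Unset Strict Implicit. Unset Printing Implicit Defensive.
Local Open Scope ring_scope.
Local Open Scope classical_set_scope.

(* Write [p k] for the k-th derivative at 0 of a Laguerre entire function.  Up to
   a constant factor [p] is nonnegative and log-concave, because multiplication by
   [s + b z] with [s, b >= 0] preserves log-concavity.  Nonnegativity bounds all the
   coefficients of [fs n] by its values on the positive axis, so pointwise
   convergence forces convergence of the coefficients, without Cauchy's formula.
   As [f] lies in A_a, for every [b > a] some ratio [p k.+1 / p k] of [f] is below
   [b]; the same then holds for [fs n] with [n] large, and log-concavity propagates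
   it to all larger [k]: this gives boundedness, hence convergence, in A_a.

   For [f] to be a Laguerre function, re-centre at a point [r > 0] with
   [f r <> 0]: every factor becomes [1 + t w] with [t] in [0, 1], where
   [w = z / r - 1] and a zero at the origin is just [t = 1].  The total weight
   [alpha + sum_j t_j] is at most [|f (2 r) / f r|], hence bounded along the
   sequence, so all the [t_j] and the total weight converge along an ultrafilter.
   Replacing the factors beyond the J-th by an exponential of the same weight costs
   O(1/J) uniformly in [n], so the limit has the same form; the weight lost
   in the limit goes into its exponential factor. *)

(** The norm of [CC R] takes values in [R[i]]; this real-valued version lets all estimates take
    place in the ordered field [R]. *)
Definition cabs (R : realType) (z : CC R) : R := ComplexField.Normc.normc (z : R[i]).
Definition rc (R : realType) (x : R) : CC R := (x%:C)%C.

(** * Real-valued modulus and convergence in the complex plane *)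

Section ComplexNorm.
Variable R : realType.
Local Notation C := (CC R).
Implicit Types (x y : R) (z w : C).

Lemma cabsE z : `|z| = rc (cabs z) :> C.
Proof. by []. Qed.

Lemma rc_le x y : (rc x <= rc y :> C) = (x <= y).
Proof. exact: lecR. Qed.

Lemma rc_lt x y : (rc x < rc y :> C) = (x < y).
Proof. exact: ltcR. Qed.

Lemma rc_inj : injective (@rc R).
Proof. by move=> x y []. Qed.

Lemma rcD x y : rc (x + y) = rc x + rc y. Proof. exact: (rmorphD (real_complex R)). Qed.
Lemma rcB x y : rc (x - y) = rc x - rc y. Proof. exact: (rmorphB (real_complex R)). Qed.
Lemma rcM x y : rc (x * y) = rc x * rc y. Proof. exact: (rmorphM (real_complex R)). Qed.
Lemma rcX x n : rc (x ^+ n) = rc x ^+ n. Proof. exact: (rmorphXn (real_complex R)). Qed.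
Lemma rcV x : rc x^-1 = (rc x)^-1. Proof. exact: (fmorphV (real_complex R)). Qed.
Lemma rc0 : rc 0 = 0 :> C. Proof. by []. Qed.
Lemma rc1 : rc 1 = 1 :> C. Proof. by []. Qed.
Lemma rc_nat n : rc n%:R = n%:R :> C. Proof. exact: (rmorph_nat (real_complex R)). Qed.
Lemma rc_sum n (u : nat -> R) : rc (\sum_(k < n) u k) = \sum_(k < n) rc (u k).
Proof. exact: (rmorph_sum (real_complex R)). Qed.
Lemma rc_prod n (u : nat -> R) : rc (\prod_(k < n) u k) = \prod_(k < n) rc (u k).
Proof. exact: (rmorph_prod (real_complex R)). Qed.

Lemma cabs_ge0 z : 0 <= cabs z.
Proof. by rewrite -rc_le -cabsE normr_ge0. Qed.

Lemma cabsM z w : cabs (z * w) = cabs z * cabs w.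
Proof. by apply: rc_inj; rewrite rcM -!cabsE normrM. Qed.

Lemma cabsN z : cabs (- z) = cabs z.
Proof. by apply: rc_inj; rewrite -!cabsE normrN. Qed.

Lemma cabsB z w : cabs (z - w) = cabs (w - z).
Proof. by rewrite -cabsN opprB. Qed.

Lemma cabsV z : cabs z^-1 = (cabs z)^-1.
Proof. by apply: rc_inj; rewrite rcV -!cabsE normfV. Qed.

Lemma cabsX z n : cabs (z ^+ n) = cabs z ^+ n.
Proof. by apply: rc_inj; rewrite rcX -!cabsE normrX. Qed.

Lemma cabsD z w : cabs (z + w) <= cabs z + cabs w.
Proof. by rewrite -rc_le rcD -!cabsE ler_normD. Qed.

Lemma cabs_rc x : cabs (rc x) = `|x|.
Proof. by rewrite /cabs /rc /= expr0n addr0 sqrtr_sqr. Qed.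

Lemma cabs0 : cabs (0 : C) = 0. Proof. by rewrite -rc0 cabs_rc normr0. Qed.
Lemma cabs1 : cabs (1 : C) = 1. Proof. by rewrite -rc1 cabs_rc normr1. Qed.

Lemma cabs_eq0 z : (cabs z == 0) = (z == 0).
Proof. by rewrite -[RHS]normr_eq0 cabsE -rc0 (inj_eq rc_inj). Qed.

Lemma cabs_sum (I : Type) (s : seq I) (P : pred I) (F : I -> C) :
  cabs (\sum_(i <- s | P i) F i) <= \sum_(i <- s | P i) cabs (F i).
Proof.
apply: (big_ind2 (fun z x => cabs z <= x)) => //; first by rewrite cabs0.
by move=> z x w y zx wy; apply: le_trans (cabsD _ _) (lerD zx wy).
Qed.

Lemma cabs_prod (I : Type) (s : seq I) (P : pred I) (F : I -> C) :
  cabs (\prod_(i <- s | P i) F i) = \prod_(i <- s | P i) cabs (F i).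
Proof. exact: (big_morph _ cabsM cabs1). Qed.

Lemma cabs_Re z : `|complex.Re (z : R[i])| <= cabs z.
Proof. by rewrite -rc_le; exact: normc_ge_Re. Qed.

Lemma cabs_Im z : `|complex.Im (z : R[i])| <= cabs z.
Proof.
case: z => a b /=; rewrite /cabs /= -(sqrtr_sqr b) ler_sqrt ?addr_ge0 ?sqr_ge0//.
by rewrite lerDr sqr_ge0.
Qed.

Lemma cvg_cabs (T : Type) (F : set_system T) (FF : Filter F) (u : T -> C) (l : C) :
  u @ F --> l <-> cabs (u t - l) @[t --> F] --> 0.
Proof.
split=> [/cvgrPdist_lt ul|/cvgr0Pnorm_lt ul].
  apply/cvgr0Pnorm_lt => e e0.
  have : (0 : C) < rc e by rewrite -rc0 rc_lt.
  move=> /ul; apply: filterS => t; rewrite cabsE rc_lt cabsB.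
  by rewrite ger0_norm ?cabs_ge0.
(* The radius is an element of [R[i]]; being positive, it has imaginary part 0 and positive real
   part [e]. *)
apply/cvgrPdist_lt => -[e e'] e0.
have : 0 < e by move: e0; rewrite ltcE /= => /andP[].
move=> /ul; apply: filterS => t; rewrite ger0_norm ?cabs_ge0 // cabsB => te.
by move: e0; rewrite cabsE !ltcE /= => /andP[-> _].
Qed.

Lemma cvg_cabs_norm (T : Type) (F : set_system T) (FF : Filter F) (u : T -> C) (l : C) :
  u @ F --> l -> cabs (u t) @[t --> F] --> cabs l.
Proof.
move=> /cvg_cabs ul; apply/cvgrPdist_lt => e e0.
move/cvgr0Pnorm_lt: ul => /(_ _ e0); apply: filterS => t; apply: le_lt_trans.
rewrite (ger0_norm (cabs_ge0 _)) ler_norml.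
have := cabsD (u t - l) l; have := cabsD (l - u t) (u t).
by rewrite !subrK cabsB; lra.
Qed.

Lemma cvg_rc (T : Type) (F : set_system T) (FF : Filter F) (u : T -> R) (l : R) :
  u @ F --> l -> rc (u t) @[t --> F] --> rc l.
Proof.
move=> ul; apply/cvg_cabs; have : (u t - l) @[t --> F] --> (0 : R).
  by rewrite -(subrr l); apply: cvgB => //; exact: cvg_cst.
have -> : (fun t => cabs (rc (u t) - rc l)) = (fun t => `|u t - l|).
  by apply/funext => t; rewrite -rcB cabs_rc.
by move=> /cvg_norm; rewrite normr0.
Qed.

Lemma cvg_complex (u : nat -> C) (a b : R) :
  complex.Re (u n : R[i]) @[n --> \oo] --> a ->
  complex.Im (u n : R[i]) @[n --> \oo] --> b ->
  u @ \oo --> rc a + rc b * ('i%C : C).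
Proof.
move=> ua ub; have -> : u = (fun n => rc (complex.Re (u n : R[i])) +
    rc (complex.Im (u n : R[i])) * ('i%C : C)).
  by apply/funext => n; rewrite [LHS]complexE mulrC.
by apply: cvgD; [exact: cvg_rc|apply: cvgM; [exact: cvg_rc|exact: cvg_cst]].
Qed.

Lemma limC_unique (u : nat -> C) (l l' : C) : u @ \oo --> l -> u @ \oo --> l' -> l = l'.
Proof. by move=> ul ul'; exact: (cvg_unique (@norm_hausdorff _ _) ul ul'). Qed.

End ComplexNorm.

(** * Everywhere convergent power series and their termwise differentiation *)

Section PowerSeries.
Variable R : realType.
Local Notation C := (CC R).
Local Notation K := (R[i] : numFieldType).
Implicit Types (c u : nat -> C) (f : C -> C) (r M : R).

Lemma cabs_lim_le (T : Type) (F : set_system T) (FF : ProperFilter F) (u : T -> C) (l : C) M :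
  u @ F --> l -> (\forall t \near F, cabs (u t) <= M) -> cabs l <= M.
Proof. by move=> /cvg_cabs_norm ul uM; exact: (cvgr_to_le ul). Qed.

Lemma dominated_sum_le u M : (forall k, cabs (u k) <= M / 2 ^+ k) ->
  forall N n, (N <= n)%N ->
    cabs (\sum_(k < n) u k - \sum_(k < N) u k) <= M * 2 / 2 ^+ N.
Proof.
move=> uM N n /subnKC <-; move: (n - N)%N => m.
have M0 : 0 <= M by have := le_trans (cabs_ge0 _) (uM 0%N); rewrite expr0 divr1.
(* Subtracting the geometric tail makes the estimate close under induction on [m]. *)
suff : cabs (\sum_(k < N + m) u k - \sum_(k < N) u k) <= M * 2 / 2 ^+ N - M * 2 / 2 ^+ (N + m).
  by move/le_trans; apply; rewrite lerBlDr lerDl !mulr_ge0 // invr_ge0 exprn_ge0.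
elim: m => [|m IH]; first by rewrite addn0 !subrr cabs0.
rewrite addnS big_ord_recr /= addrAC.
apply: le_trans (cabsD _ _) _; apply: le_trans (lerD IH (uM _)) _.
rewrite exprS invfM; have := exprn_gt0 (N + m) (ltr0Sn R 1).
set p := 2 ^+ (N + m) => p0; lra.
Qed.

(** Completeness of [R] is applied to the real and imaginary parts, each dominated by a geometric
    series. *)
Lemma dominated_sum_cvg u M : (forall k, cabs (u k) <= M / 2 ^+ k) ->
  exists s : C, (fun N => \sum_(k < N) u k) @ \oo --> s.
Proof.
move=> uM.
have real_part (v : nat -> R) : (forall k, `|v k| <= cabs (u k)) ->
    exists s : R, (fun N => \sum_(k < N) v k) @ \oo --> s.
  move=> vu; suff /cvg_ex[s vs] : cvgn (series v).
    exists s; move: vs; rewrite (_ : series v = fun N => \sum_(k < N) v k) //.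
    by apply/funext => N; rewrite /series /= big_mkord.
  apply: normed_cvg; apply: (@series_le_cvg _ _ (geometric M 2^-1)).
  - by move=> n /=; exact: normr_ge0.
  - move=> n /=; rewrite exprVn; apply: le_trans (uM n); exact: cabs_ge0.
  - by move=> n /=; rewrite exprVn; apply: le_trans (uM n); exact: vu.
  - by apply: is_cvg_geometric_series; rewrite ger0_norm ?invr_ge0// invf_lt1// ltr1n.
have [a ha] := real_part (fun k => complex.Re (u k : R[i])) (fun k => cabs_Re _).
have [b hb] := real_part (fun k => complex.Im (u k : R[i])) (fun k => cabs_Im _).
exists (rc a + rc b * ('i%C : C)); apply: cvg_complex.
  have -> : (fun N => complex.Re (\sum_(k < N) u k : R[i])) =
      (fun N => \sum_(k < N) complex.Re (u k : R[i])); last exact: ha.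
  by apply/funext => N; exact: (raddf_sum (@complex.Re R)).
have -> : (fun N => complex.Im (\sum_(k < N) u k : R[i])) =
    (fun N => \sum_(k < N) complex.Im (u k : R[i])); last exact: hb.
by apply/funext => N; exact: (raddf_sum (@complex.Im R)).
Qed.

Lemma dominated_sum_tail u M s : (forall k, cabs (u k) <= M / 2 ^+ k) ->
  (fun N => \sum_(k < N) u k) @ \oo --> s ->
  forall N, cabs (s - \sum_(k < N) u k) <= M * 2 / 2 ^+ N.
Proof.
move=> uM us N.
have : (fun n => \sum_(k < n) u k - \sum_(k < N) u k) @ \oo --> s - \sum_(k < N) u k.
  exact: cvgB us (cvg_cst _).
move=> /cabs_lim_le; apply; near=> n; apply: dominated_sum_le => //.
by near: n; exact: nbhs_infty_ge.
Unshelve. all: by end_near. Qed.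

Lemma cvg_half (M : R) : M / 2 ^+ n @[n --> \oo] --> (0 : R).
Proof.
have -> : (fun n => M / 2 ^+ n) = geometric M 2^-1.
  by apply/funext => n /=; rewrite exprVn.
by apply: cvg_geometric; rewrite ger0_norm ?invr_ge0// invf_lt1// ltr1n.
Qed.

(** Infinite radius of convergence. The bound at radius [2 * r] makes the terms at radius [r] at
    most [M / 2 ^+ k], the form used in the tail estimates. *)
Definition entire_coef c := forall r, 0 <= r -> exists M, forall k, cabs (c k) * r ^+ k <= M.

(** Entire functions enter the argument through this predicate: derivatives at 0 are read off from
    the coefficients, without complex integration. *)
Definition is_ps c f := entire_coef c /\
  forall z : C, (fun N => \sum_(k < N) c k * z ^+ k) @ \oo --> f z.

Lemma ps_term_le c k (z : C) r M : cabs (c k) * (2 * r) ^+ k <= M ->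
  cabs z <= r -> cabs (c k * z ^+ k) <= M / 2 ^+ k.
Proof.
move=> cM zr; rewrite ler_pdivlMr ?exprn_gt0 // cabsM cabsX.
apply: le_trans cM; rewrite exprMn -mulrA ler_wpM2l ?cabs_ge0 // mulrC.
by rewrite ler_wpM2l ?exprn_ge0 // lerXn2r ?nnegrE ?cabs_ge0 // (le_trans _ zr) ?cabs_ge0.
Qed.

Lemma ps_tail c f r M : is_ps c f -> (forall k, cabs (c k) * (2 * r) ^+ k <= M) ->
  forall (z : C) N, cabs z <= r ->
    cabs (f z - \sum_(k < N) c k * z ^+ k) <= M * 2 / 2 ^+ N.
Proof.
move=> [_ cf] cM z N zr.
by apply: (dominated_sum_tail (u := fun k => c k * z ^+ k)) => // k; exact: ps_term_le zr.
Qed.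

Lemma ps_exists c : entire_coef c -> exists f, is_ps c f.
Proof.
move=> cE; suff /choice[f fP] : forall z : C, exists s : C,
    (fun N => \sum_(k < N) c k * z ^+ k) @ \oo --> s by exists f.
move=> z; have [|M cM] := cE (2 * cabs z); first by rewrite mulr_ge0 ?cabs_ge0.
apply: (@dominated_sum_cvg (fun k => c k * z ^+ k) M) => k.
exact: ps_term_le (cM k) (lexx _).
Qed.

Lemma ps_at0 c f : is_ps c f -> f 0 = c 0%N.
Proof.
move=> [_ /(_ 0) cf]; apply: (limC_unique cf).
apply: cvg_near_cst; near=> n.
have /prednK <- : (0 < n)%N by near: n; exact: nbhs_infty_gt.
rewrite big_ord_recl /= expr0 mulr1 big1 ?addr0 // => i _.
by rewrite /bump /= exprS mul0r mulr0.
Unshelve. all: by end_near. Qed.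

Lemma ps_sub c d f g : is_ps c f -> is_ps d g ->
  is_ps (fun k => c k - d k) (fun z => f z - g z).
Proof.
move=> [cE cf] [dE dg]; split=> [r r0|z].
  have [M cM] := cE r r0; have [M' dM] := dE r r0.
  exists (M + M') => k; apply: le_trans (lerD (cM k) (dM k)).
  rewrite -mulrDl ler_wpM2r ?exprn_ge0 //.
  by apply: le_trans (cabsD _ _) _; rewrite cabsN.
have -> : (fun N => \sum_(k < N) (c k - d k) * z ^+ k) =
    (fun N => \sum_(k < N) c k * z ^+ k - \sum_(k < N) d k * z ^+ k).
  by apply/funext => N; rewrite -sumrB; apply: eq_bigr => k _; rewrite mulrBl.
exact: cvgB.
Qed.

Definition dcoef c : nat -> C := fun k => (k.+1)%:R * c k.+1.

Lemma entire_dcoef c : entire_coef c -> entire_coef (dcoef c).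
Proof.
(* Doubling the radius absorbs the factor [k.+1]; adding 1 to [r] absorbs the shift of the
   exponent. *)
move=> cE r r0; have [|M cM] := cE (2 * (r + 1)); first by lra.
exists M => k; apply: le_trans (cM k.+1).
rewrite /dcoef cabsM -rc_nat cabs_rc normr_nat mulrC mulrA [cabs _ * _]mulrC.
rewrite ler_wpM2r ?cabs_ge0 //.
rewrite exprMn mulrC ler_pM ?exprn_ge0 //.
  by rewrite -natrX ler_nat ltnW // ltn_expl.
rewrite exprS -[X in X <= _]mul1r ler_pM ?exprn_ge0 //; first lra.
by rewrite lerXn2r ?nnegrE //; lra.
Qed.

Lemma cabs_expD1 (z h : C) k : cabs h <= 1 ->
  cabs ((h + z) ^+ k - z ^+ k) <= cabs h * (cabs z + 1) ^+ k.
Proof.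
move=> h1; elim: k => [|k IH]; first by rewrite !expr0 subrr cabs0 mulr1 cabs_ge0.
have -> : (h + z) ^+ k.+1 - z ^+ k.+1 = z * ((h + z) ^+ k - z ^+ k) + h * (h + z) ^+ k.
  by rewrite !exprS; ring.
apply: le_trans (cabsD _ _) _; rewrite !cabsM cabsX.
have := ler_wpM2l (cabs_ge0 z) IH; rewrite exprS.
have : cabs (h + z) ^+ k <= (cabs z + 1) ^+ k.
  rewrite lerXn2r ?nnegrE ?cabs_ge0 ?addr_ge0 ?cabs_ge0 //.
  by apply: le_trans (cabsD _ _) _; lra.
move/(ler_wpM2l (cabs_ge0 h)); lra.
Qed.

(** Splitting one factor [h + z] off the power, the new error is the first-order one of
    [cabs_expD1]. The growth [(cabs z + 1) ^+ k] is absorbed by entire coefficients. At [k = 0] the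
    truncated exponent [k.-1] is multiplied by 0. *)
Lemma cabs_expD2 (z h : C) k : cabs h <= 1 ->
  cabs ((h + z) ^+ k - z ^+ k - h * (k%:R * z ^+ k.-1)) <= cabs h ^+ 2 * (cabs z + 1) ^+ k.
Proof.
move=> h1; elim: k => [|k IH].
  by rewrite !expr0 !mul0r mulr0 subr0 subrr cabs0 mulr1 exprn_ge0 ?cabs_ge0.
have -> : (h + z) ^+ k.+1 - z ^+ k.+1 - h * (k.+1%:R * z ^+ k.+1.-1) =
    z * ((h + z) ^+ k - z ^+ k - h * (k%:R * z ^+ k.-1)) + h * ((h + z) ^+ k - z ^+ k).
  case: k {IH} => [|k]; rewrite ?expr0 /= ?exprS; last by rewrite -!natr1; ring.
  by rewrite expr0 expr0; ring.
apply: le_trans (cabsD _ _) _; rewrite !cabsM.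
have := ler_wpM2l (cabs_ge0 z) IH; rewrite exprS.
have := ler_wpM2l (cabs_ge0 h) (@cabs_expD1 z h k h1).
by rewrite [(cabs z + 1) ^+ k.+1]exprS; lra.
Qed.

Lemma ps_diff_le c f g (z : C) : is_ps c f -> is_ps (dcoef c) g ->
  exists M, forall h, cabs h <= 1 -> cabs (f (h + z) - f z - h * g z) <= cabs h ^+ 2 * M.
Proof.
move=> [cE cf] [_ dg]; have z0 := cabs_ge0 z.
have [|M cM] := cE (2 * (cabs z + 1)); first by lra.
exists (M * 2) => h h1.
have : (fun N => \sum_(k < N.+1) c k * (h + z) ^+ k - \sum_(k < N.+1) c k * z ^+ k
   - h * \sum_(k < N) dcoef c k * z ^+ k) @ \oo --> f (h + z) - f z - h * g z.
  apply: cvgB; last by apply: cvgM => //; exact: cvg_cst.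
  by apply: cvgB;
    rewrite (cvg_shiftS (fun N => \sum_(k < N) c k * _ ^+ k)).
move=> /cabs_lim_le; apply; apply: nearW => N.
(* The term of index 0 vanishes after differentiation, so [N] terms of the derivative match [N.+1]
   terms of the series. *)
have -> : \sum_(k < N) dcoef c k * z ^+ k = \sum_(k < N.+1) c k * (k%:R * z ^+ k.-1).
  rewrite [RHS]big_ord_recl /= mul0r mulr0 add0r; apply: eq_bigr => k _.
  by rewrite /dcoef /bump /= add1n mulrCA mulrA.
rewrite mulr_sumr -!sumrB.
have -> : \sum_(k < N.+1) (c k * (h + z) ^+ k - c k * z ^+ k - h * (c k * (k%:R * z ^+ k.-1)))
  = \sum_(k < N.+1) c k * ((h + z) ^+ k - z ^+ k - h * (k%:R * z ^+ k.-1)).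
  by apply: eq_bigr => k _; ring.
apply: le_trans (cabs_sum _ _ _) _.
apply: (@le_trans _ _ (\sum_(k < N.+1) cabs h ^+ 2 * (M / 2 ^+ k))).
  apply: ler_sum => k _; rewrite cabsM.
  apply: le_trans (ler_wpM2l (cabs_ge0 _) (cabs_expD2 z k h1)) _.
  rewrite mulrCA ler_wpM2l ?exprn_ge0 ?cabs_ge0 //.
  by rewrite ler_pdivlMr ?exprn_gt0 // -mulrA -exprMn [_ * 2]mulrC.
rewrite -mulr_sumr ler_wpM2l ?exprn_ge0 ?cabs_ge0 //.
have M0 : 0 <= M by apply: le_trans (cM 0%N); rewrite expr0 mulr1 cabs_ge0.
(* The domination lemma, applied to the geometric series itself, bounds its partial sums by
   [M * 2]. *)
have /(_ (fun k => rc (M / 2 ^+ k)) M) := @dominated_sum_le.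
move=> /(_ _ 0%N N.+1 (leq0n _)); rewrite big_ord0 subr0.
rewrite -(rc_sum _ (fun k => M / 2 ^+ k)) cabs_rc expr0 divr1.
rewrite ger0_norm ?sumr_ge0 //; last by move=> i _; rewrite divr_ge0 ?exprn_ge0.
by apply=> k; rewrite cabs_rc ger0_norm // divr_ge0 ?exprn_ge0.
Qed.

(** Dividing the estimate of [ps_diff_le] by [h] leaves an error of at most [cabs h * M]. *)
Lemma ps_derive c f g (z : C) : is_ps c f -> is_ps (dcoef c) g ->
  h^-1 *: (f (h + z) - f z) @[h --> (0 : K)^'] --> g z.
Proof.
move=> cf dg; have [M fM] := ps_diff_le z cf dg.
have cvg_h : cabs (h : C) @[h --> (0 : K)^'] --> (0 : R).
  have : (h : C) @[h --> (0 : K)^'] --> (0 : C) by apply: cvg_within_filter; exact: cvg_id.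
  by move=> /cvg_cabs; under eq_fun do rewrite subr0.
apply/cvg_cabs.
apply: (@squeeze_cvgr _ _ _ _ (fun=> 0) (fun h : K => cabs (h : C) * M)); last 2 first.
- exact: cvg_cst.
- by rewrite -[X in _ --> X](mul0r M); apply: cvgM => //; exact: cvg_cst.
near=> h; rewrite cabs_ge0 /=.
have h0 : h != 0 by near: h; exact: nbhs_dnbhs_neq.
have h1 : cabs (h : C) <= 1.
  near: h; move/cvgr0Pnorm_le: cvg_h => /(_ 1 ltr01); apply: filterS => h.
  by rewrite ger0_norm ?cabs_ge0.
have -> : h^-1 *: (f (h + z) - f z) - g z = (h^-1 : C) * (f (h + z) - f z - (h : C) * g z).
  by rewrite mulrBr mulKf.
have ch0 : cabs (h : C) != 0 by rewrite cabs_eq0.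
rewrite cabsM cabsV ler_pdivrMl ?lt_neqAle ?cabs_ge0 ?andbT 1?eq_sym //.
by rewrite mulrA -expr2; exact: fM.
Unshelve. all: by end_near. Qed.

Lemma ps_derive1 c f : is_ps c f -> is_ps (dcoef c) (derive1 f).
Proof.
move=> cf; have [g dg] := ps_exists (entire_dcoef (proj1 cf)).
suff -> : derive1 f = g by [].
apply/funext => z; rewrite /derive1.
apply: cvg_lim; [exact: norm_hausdorff|exact: ps_derive cf dg].
Qed.

Lemma ps_derive1n c f n : is_ps c f ->
  is_ps (fun k => ((n + k)`!%:R / k`!%:R) * c (n + k)%N) (derive1n n f).
Proof.
move=> cf; elim: n => [|n /ps_derive1 IH].
  rewrite derive1n0; move: cf; congr is_ps; apply/funext => k.
  by rewrite divff ?mul1r // pnatr_eq0 -lt0n fact_gt0.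
rewrite derive1nS; move: IH; congr is_ps; apply/funext => k.
rewrite /dcoef mulrA addnS addSn; congr (_ * _).
have k1 : (k.+1%:R : C) != 0 by rewrite pnatr_eq0.
by rewrite [k.+1`!]factS natrM mulrCA invfM mulVKf.
Qed.

Lemma ps_derive1n0 c f n : is_ps c f -> derive1n n f 0 = n`!%:R * c n.
Proof. by move=> /(ps_derive1n n)/ps_at0 ->; rewrite addn0 divr1. Qed.

Lemma ps_continuous c f (z : C) : is_ps c f -> {for z, continuous f}.
Proof.
move=> cf; have [g dg] := ps_exists (entire_dcoef (proj1 cf)).
have [M fM] := ps_diff_le z cf dg.
have cvg_dist : cabs (w - z) @[w --> z] --> (0 : R).
  by apply: (iffLR (cvg_cabs (nbhs_filter z) id z)); exact: cvg_id.
apply: (iffRL (cvg_cabs (nbhs_filter z) f (f z))).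
apply: (@squeeze_cvgr _ _ _ _ (fun=> 0)
  (fun w : C => cabs (w - z) * cabs (w - z) * M + cabs (w - z) * cabs (g z))); last 2 first.
- exact: cvg_cst.
- have -> : (0 : R) = 0 * 0 * M + 0 * cabs (g z) by rewrite !mul0r addr0.
  by apply: cvgD; apply: cvgM; [exact: cvgM|exact: cvg_cst| |exact: cvg_cst].
near=> w; rewrite cabs_ge0 /=.
have h1 : cabs (w - z) <= 1.
  near: w; move/cvgr0Pnorm_le: cvg_dist => /(_ 1 ltr01); apply: filterS => h.
  by rewrite ger0_norm ?cabs_ge0.
have := fM _ h1; rewrite subrK expr2 => H.
have -> : f w - f z = f w - f z - (w - z) * g z + (w - z) * g z by rewrite subrK.
by apply: le_trans (cabsD _ _) _; rewrite cabsM lerD.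
Unshelve. all: by end_near. Qed.

End PowerSeries.

(** * Products of truncated exponential series *)

Local Notation exp_sum x N := (\sum_(k < N) x ^+ k / k`!%:R).

Section ExpSum.
Variable F : numFieldType.
Implicit Types x y : F.

Lemma fact_neq0 n : n`!%:R != 0 :> F.
Proof. by rewrite pnatr_eq0 -lt0n fact_gt0. Qed.

Lemma sum_antidiagonals (G : nat -> nat -> F) N :
  \sum_(k < N) \sum_(i < k.+1) G i (k - i)%N = \sum_(i < N) \sum_(j < N - i) G i j.
Proof.
elim: N => [|N IH]; first by rewrite !big_ord0.
rewrite big_ord_recr /= IH [in RHS]big_ord_recr /= subSnn big_ord1.
rewrite big_ord_recr /= subnn addrA; congr (_ + _); rewrite -big_split /=.
by apply: eq_bigr => i _; rewrite subSn 1?ltnW // big_ord_recr.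
Qed.

Lemma exp_coeffD x y k : (x + y) ^+ k / k`!%:R =
  \sum_(i < k.+1) (x ^+ i / i`!%:R) * (y ^+ (k - i) / (k - i)`!%:R).
Proof.
rewrite addrC exprDn mulr_suml; apply: eq_bigr => -[i /=]; rewrite ltnS => ik _.
rewrite -(bin_fact ik) !natrM -mulr_natr.
have C0 : 'C(k, i)%:R != 0 :> F by rewrite pnatr_eq0 -lt0n bin_gt0.
by rewrite !invfM -!mulrA mulVKf //; ring.
Qed.

(** The product of two truncations runs over a square of index pairs, the truncation for [x + y]
    over a triangle in it; the right-hand side is the rest of the square. Its monomials have
    nonnegative coefficients, so it can be dominated by its value at the moduli. *)
Lemma exp_sumM x y N : exp_sum x N * exp_sum y N - exp_sum (x + y) N =
  \sum_(i < N) x ^+ i / i`!%:R * (exp_sum y N - exp_sum y (N - i)).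
Proof.
under [X in _ - X]eq_bigr do rewrite exp_coeffD.
rewrite (sum_antidiagonals (fun i j => x ^+ i / i`!%:R * (y ^+ j / j`!%:R))).
rewrite mulr_suml -sumrB; apply: eq_bigr => i _.
by rewrite mulrBr -[X in _ - X]mulr_sumr.
Qed.

End ExpSum.

(** * The complex exponential *)

Section ComplexExp.
Variable R : realType.
Local Notation C := (CC R).
Implicit Types (z w : C) (x : R).

Lemma cvg_exp_sum x : (fun N => exp_sum x N) @ \oo --> expR x.
Proof.
rewrite (_ : (fun N => exp_sum x N) = series (exp_coeff x)); first exact: is_cvg_series_exp_coeff.
by apply/funext => N; rewrite /series /= big_mkord.
Qed.

Arguments cvg_exp_sum : clear implicits.

Lemma exp_sum_le x N : 0 <= x -> exp_sum x N <= expR x.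
Proof.
move=> x0; apply: (cvgr_to_ge (cvg_exp_sum x)); near=> n.
have /subnKC <- : (N <= n)%N by near: n; exact: nbhs_infty_ge.
rewrite big_split_ord /= lerDl sumr_ge0 // => i _.
by rewrite divr_ge0 ?exprn_ge0.
Unshelve. all: by end_near. Qed.

Lemma exp_term_le x k : 0 <= x -> x ^+ k / k`!%:R <= expR x.
Proof.
move=> x0; apply: le_trans (exp_sum_le k.+1 x0).
rewrite big_ord_recr /= lerDr sumr_ge0 // => i _.
by rewrite divr_ge0 ?exprn_ge0.
Qed.

Lemma cabs_exp_term z k : cabs (z ^+ k / k`!%:R) = cabs z ^+ k / k`!%:R.
Proof. by rewrite cabsM cabsX cabsV -rc_nat cabs_rc normr_nat. Qed.

Lemma cexp_ps : is_ps (fun k => (k`!%:R)^-1) (@cexp R).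
Proof.
have [|f cf] := @ps_exists R (fun k => (k`!%:R)^-1).
  move=> r r0; exists (expR r) => k; apply: le_trans (exp_term_le k r0).
  by rewrite cabsV -rc_nat cabs_rc normr_nat mulrC.
suff -> : @cexp R = f by [].
apply/funext => z; apply: cvg_lim; first exact: norm_hausdorff.
have := proj2 cf z; rewrite (_ : series _ = fun N => \sum_(k < N) (k`!%:R)^-1 * z ^+ k) //.
by apply/funext => N; rewrite /series /= big_mkord; apply: eq_bigr => k _; rewrite mulrC.
Qed.

Lemma cvg_cexp_sum z : (fun N => exp_sum z N) @ \oo --> cexp z.
Proof.
have := proj2 cexp_ps z.
rewrite (_ : (fun N => exp_sum z N) = fun N => \sum_(k < N) (k`!%:R)^-1 * z ^+ k) //.
by apply/funext => N; apply: eq_bigr => k _; rewrite mulrC.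
Qed.

Arguments cvg_cexp_sum : clear implicits.

Lemma cabs_exp_sum z N : cabs (exp_sum z N) <= exp_sum (cabs z) N.
Proof.
apply: le_trans (cabs_sum _ _ _) _; apply: ler_sum => k _.
by rewrite cabs_exp_term.
Qed.

Lemma cabs_exp_sumB z M N : (M <= N)%N ->
  cabs (exp_sum z N - exp_sum z M) <= exp_sum (cabs z) N - exp_sum (cabs z) M.
Proof.
move=> /subnKC <-; rewrite !big_split_ord /=.
have cancel (V : zmodType) (a b : V) : a + b - a = b by rewrite addrC addKr.
rewrite !cancel.
apply: le_trans (cabs_sum _ _ _) _; apply: ler_sum => k _.
by rewrite cabs_exp_term.
Qed.

Lemma cabs_cexp z : cabs (cexp z) <= expR (cabs z).
Proof.
apply: cabs_lim_le (cvg_cexp_sum z) _; apply: nearW => N.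
by apply: le_trans (cabs_exp_sum _ _) (exp_sum_le _ _); exact: cabs_ge0.
Qed.

(** By [exp_sumM] the defect of multiplicativity of the truncations at [z] and [w] is dominated by
    the one at [cabs z] and [cabs w], which tends to 0 by the real identity [expRD]. *)
Lemma cexpD z w : cexp (z + w) = cexp z * cexp w.
Proof.
apply/eqP; rewrite -subr_eq0 -cabs_eq0 eq_le cabs_ge0 andbT cabsB.
have cvgC : (fun N => exp_sum z N * exp_sum w N - exp_sum (z + w) N) @ \oo -->
    cexp z * cexp w - cexp (z + w).
  exact: cvgB (cvgM (cvg_cexp_sum z) (cvg_cexp_sum w)) (cvg_cexp_sum _).
have cvgR : (fun N => exp_sum (cabs z) N * exp_sum (cabs w) N
    - exp_sum (cabs z + cabs w) N) @ \oo --> (0 : R).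
  rewrite -[X in _ --> X](subrr (expR (cabs z + cabs w))) {1}expRD.
  exact: cvgB (cvgM (cvg_exp_sum _) (cvg_exp_sum _)) (cvg_exp_sum _).
apply: (ler_cvg_to (cvg_cabs_norm _ cvgC) cvgR); apply: nearW => N.
rewrite !exp_sumM; apply: le_trans (cabs_sum _ _ _) _; apply: ler_sum => i _.
rewrite cabsM cabs_exp_term ler_wpM2l ?divr_ge0 ?exprn_ge0 ?cabs_ge0 //.
by apply: cabs_exp_sumB; exact: leq_subr.
Qed.

Lemma cexp0 : cexp (0 : C) = 1.
Proof. by rewrite (ps_at0 cexp_ps) invr1. Qed.

Lemma cexpN z : cexp (- z) * cexp z = 1.
Proof. by rewrite -cexpD addNr cexp0. Qed.

Lemma cexp_neq0 z : cexp z != 0.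
Proof.
by apply/eqP => e0; have /esym/eqP := cexpN z; rewrite e0 mulr0 oner_eq0.
Qed.

Lemma cexp_rc x : cexp (rc x) = rc (expR x).
Proof.
apply: (limC_unique (cvg_cexp_sum _)).
rewrite (_ : (fun N => exp_sum (rc x) N) = fun N => rc (exp_sum x N)); last first.
  apply/funext => N; rewrite (rc_sum _ (fun k => x ^+ k / k`!%:R)).
  by apply: eq_bigr => k _; rewrite rcM rcX rcV rc_nat.
exact: cvg_rc (cvg_exp_sum x).
Qed.

(** The terms from index 2 on are compared with [cabs z ^+ 2] times the exponential series, as
    (k+2)! >= k!. *)
Lemma cabs_cexpB1z z : cabs (cexp z - (1 + z)) <= cabs z ^+ 2 * expR (cabs z).
Proof.
have : (fun N => exp_sum z N.+2 - (1 + z)) @ \oo --> cexp z - (1 + z).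
  apply: cvgB; last exact: cvg_cst.
  rewrite (cvg_shiftS (fun N => exp_sum z N.+1)) (cvg_shiftS (fun N => exp_sum z N)).
  exact: cvg_cexp_sum.
move=> /cabs_lim_le; apply; apply: nearW => N.
rewrite 2!big_ord_recl /= /bump /= expr0 expr1 !divr1 addrA [_ + _ - _]addrC addKr.
apply: le_trans (cabs_sum _ _ _) _.
apply: (@le_trans _ _ (cabs z ^+ 2 * exp_sum (cabs z) N)).
  rewrite mulr_sumr; apply: ler_sum => i _; rewrite /bump /= !add1n.
  rewrite cabs_exp_term mulrA -exprD add2n ler_wpM2l ?exprn_ge0 ?cabs_ge0 //.
  rewrite lef_pV2 ?posrE ?ltr0n ?fact_gt0 // ler_nat !factS mulnA.
  by rewrite leq_pmull // muln_gt0.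
by rewrite ler_wpM2l ?exprn_ge0 ?exp_sum_le ?cabs_ge0.
Qed.

Lemma cvg_cexp (T : Type) (G : set_system T) (FG : Filter G) (u : T -> C) (l : C) :
  u @ G --> l -> cexp (u t) @[t --> G] --> cexp l.
Proof. by move=> ul; apply: continuous_cvg ul; exact: ps_continuous cexp_ps. Qed.

End ComplexExp.

(** * Log-concave sequences and multiplication by linear factors *)

Section LogConcave.
Variable R : realType.
Implicit Types (p : nat -> R) (s b : R).

(* The second clause with [i < j] excludes internal zeros. *)
Definition logcv p := (forall k, 0 <= p k) /\
  forall i j, (i <= j)%N -> p i * p j.+1 <= p i.+1 * p j.

(* If [p k] is the k-th derivative of [f] at 0, this is that of [(s + b z) f z]. *)
Definition mulfac s b p : nat -> R := fun k => s * p k + b * (k%:R * p k.-1).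

Lemma logcv_exp s : 0 <= s -> logcv (GRing.exp s).
Proof.
by move=> s0; split=> [k|i j _]; [exact: exprn_ge0|rewrite -!exprD addSnnS].
Qed.

(** The inequality is quadratic in [s] and [b] and holds coefficient by coefficient: [F0] for s^2,
    [F1] for s b, [F2] for b^2. *)
Lemma logcv_mulfac s b p : 0 <= s -> 0 <= b -> logcv p -> logcv (mulfac s b p).
Proof.
move=> s0 b0 [p0 pL]; split=> [k|i j ij].
  by rewrite addr_ge0 ?mulr_ge0.
have F0 := pL _ _ ij.
have F2 : i%:R * j.+1%:R * (p i.-1 * p j) <= i.+1%:R * j%:R * (p i * p j.-1).
  case: i ij {F0} => [|i] ij; first by rewrite mul0r mul0r !mulr_ge0.
  case: j ij => [//|j] ij /=; apply: ler_pM; rewrite ?mulr_ge0 //; last exact: pL.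
  by rewrite -!natrM ler_nat mulSn mulnS addnC mulSn mulnS; lia.
have F1 : j.+1%:R * (p i * p j) + i%:R * (p i.-1 * p j.+1) <=
    j%:R * (p i.+1 * p j.-1) + i.+1%:R * (p i * p j).
  case: i ij {F0 F2} => [|i] ij.
    rewrite mul0r addr0; case: j ij => [|j] ij; first by rewrite mul0r add0r.
    have := ler_wpM2l (ler0n R j.+1) (pL 0%N j isT) => /=; rewrite -!natr1; lra.
  case: j ij => [//|j]; rewrite leq_eqVlt => /orP[/eqP[->]|ij] /=.
    by rewrite addrC (mulrC (p j)).
  (* With X = [p i.+1 * p j.+1], Y = [p i * p j.+2], Z = [p i.+2 * p j], I = i+1 and J = j+1, the
     claim is (J - I) X + I Y <= J Z, which follows from Y <= X <= Z and I <= J. *)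
  have XZ := pL i.+1 j ij; have YX := pL i j.+1 (leqW (ltnW ij)).
  have ji : (i.+1%:R : R) <= j.+1%:R by rewrite ler_nat ltnW.
  have H1 := ler_wpM2l (ler0n R i.+1) (le_trans YX XZ).
  have : 0 <= (j.+1%:R - i.+1%:R : R) by rewrite subr_ge0.
  move=> /ler_wpM2l/(_ _ _ XZ); move: H1; rewrite -(natr1 i.+1) -(natr1 j.+1).
  set I := i.+1%:R; set J := j.+1%:R; lra.
have := ler_wpM2l (mulr_ge0 s0 s0) F0.
have := ler_wpM2l (mulr_ge0 s0 b0) F1.
have := ler_wpM2l (mulr_ge0 b0 b0) F2.
rewrite /mulfac /=; lra.
Qed.

Lemma logcv_lim (ps : nat -> nat -> R) p : (forall n, logcv (ps n)) ->
  (forall k, ps n k @[n --> \oo] --> p k) -> logcv p.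
Proof.
move=> psL cp; split=> [k|i j ij].
  by apply: (cvgr_to_ge (cp k)); apply: nearW => n; case: (psL n).
apply: (ler_cvg_to (cvgM (cp i) (cp j.+1)) (cvgM (cp i.+1) (cp j))).
by apply: nearW => n; have [_] := psL n; exact.
Qed.

Lemma mulfac_coef s b p k : mulfac s b p k / k`!%:R =
  s * (p k / k`!%:R) + b * (if k is k'.+1 then p k' / k'`!%:R else 0).
Proof.
rewrite /mulfac mulrDl -!mulrA; congr (_ + b * _).
case: k => [|k] /=; first by rewrite mul0r.
by rewrite factS natrM invfM mulrCA mulVKf // pnatr_eq0.
Qed.

Lemma mulfac_coef_le s b p (r B : R) : 0 <= s -> 0 <= b -> 0 <= r ->
  (forall k, p k / k`!%:R * r ^+ k <= B) -> 0 <= B ->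
  forall k, mulfac s b p k / k`!%:R * r ^+ k <= (s + b * r) * B.
Proof.
move=> s0 b0 r0 pB B0 k; rewrite mulfac_coef !mulrDl -(mulrA s) -2!(mulrA b).
apply: lerD; first exact: ler_wpM2l.
apply: ler_wpM2l => //; case: k => [|k]; first by rewrite mul0r mulr_ge0.
by rewrite exprS mulrCA ler_wpM2l // -mulrA.
Qed.

End LogConcave.

Lemma cvg_sum_ord (K : numFieldType) (V : normedModType K) (T : Type)
    (F : set_system T) (FF : Filter F) (u : T -> nat -> V) (l : nat -> V) N :
  (forall k, (k < N)%N -> u t k @[t --> F] --> l k) ->
  \sum_(k < N) u t k @[t --> F] --> \sum_(k < N) l k.
Proof.
elim: N => [|N IH] ul.
  by rewrite big_ord0; under eq_fun do rewrite big_ord0; exact: cvg_cst.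
rewrite big_ord_recr /=; under eq_fun do rewrite big_ord_recr /=.
by apply: cvgD; [apply: IH => k kN; apply: ul; exact: ltnW|exact: ul].
Qed.
Arguments cvg_sum_ord {K V T F FF} u l N _.

(** * Taylor coefficients of Laguerre entire functions *)

Section LaguerreSeries.
Variable R : realType.
Local Notation C := (CC R).
Implicit Types (c : nat -> C) (f g : C -> C) (p beta : nat -> R).

Lemma ps_scale c f (a : C) : is_ps c f -> is_ps (fun k => a * c k) (fun z => a * f z).
Proof.
move=> [cE cf]; split=> [r r0|z].
  have [M cM] := cE r r0; exists (cabs a * M) => k.
  by rewrite cabsM -mulrA ler_wpM2l ?cabs_ge0.
rewrite (_ : (fun N => _) = fun N => a * \sum_(k < N) c k * z ^+ k).
  exact: cvgM (cvg_cst _) (cf z).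
by apply/funext => N; rewrite mulr_sumr; apply: eq_bigr => k _; rewrite mulrA.
Qed.

Lemma ps_dilate c f (a : C) : is_ps c f ->
  is_ps (fun k => c k * a ^+ k) (fun z => f (a * z)).
Proof.
move=> [cE cf]; split=> [r r0|z].
  have [|M cM] := cE (cabs a * r); first by rewrite mulr_ge0 ?cabs_ge0.
  by exists M => k; rewrite cabsM cabsX -mulrA -exprMn.
rewrite (_ : (fun N => _) = fun N => \sum_(k < N) c k * (a * z) ^+ k); first exact: cf.
by apply/funext => N; apply: eq_bigr => k _; rewrite exprMn mulrA.
Qed.

Lemma ps_mul_linear c f (s b : C) : is_ps c f ->
  is_ps (fun k => s * c k + b * (if k is k'.+1 then c k' else 0))
        (fun z => (s + b * z) * f z).
Proof.
move=> [cE cf]; split=> [r r0|z].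
  have [M cM] := cE r r0; exists (cabs s * M + cabs b * (r * M)) => k.
  have M0 : 0 <= M by apply: le_trans (cM 0%N); rewrite mulr_ge0 ?cabs_ge0.
  apply: (@le_trans _ _ ((cabs s * cabs (c k)
      + cabs b * cabs (if k is k'.+1 then c k' else 0)) * r ^+ k)).
    rewrite ler_wpM2r ?exprn_ge0 //.
    by apply: le_trans (cabsD _ _) _; rewrite !cabsM.
  rewrite mulrDl -!mulrA lerD // ler_wpM2l ?cabs_ge0 //.
  case: k => [|k]; first by rewrite cabs0 mul0r mulr_ge0.
  by rewrite exprS mulrCA ler_wpM2l.
rewrite -cvg_shiftS.
rewrite (_ : [sequence _]_n = fun N => s * (\sum_(k < N.+1) c k * z ^+ k)
    + b * z * (\sum_(k < N) c k * z ^+ k)).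
  rewrite mulrDl; apply: cvgD.
    apply: cvgM; first exact: cvg_cst.
    by rewrite (cvg_shiftS (fun N => \sum_(k < N) c k * z ^+ k)); exact: cf.
  by apply: cvgM; [exact: cvg_cst|exact: cf].
apply/funext => N /=.
under eq_bigr do rewrite mulrDl; rewrite big_split /=; congr (_ + _).
  by rewrite mulr_sumr; apply: eq_bigr => k _; rewrite mulrA.
rewrite big_ord_recl /= mulr0 mul0r add0r mulr_sumr; apply: eq_bigr => k _.
by rewrite /bump /= add1n exprS; ring.
Qed.

(** The uniform coefficient bound makes the series tails small uniformly in [n], so the limits in
    [n] and [N] may be exchanged. *)
Lemma ps_lim (cs : nat -> nat -> C) (fs : nat -> C -> C) c f :
  (forall n, is_ps (cs n) (fs n)) ->
  (forall r, 0 <= r -> exists M, forall n k, cabs (cs n k) * r ^+ k <= M) ->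
  (forall k, cs n k @[n --> \oo] --> c k) ->
  (forall z, fs n z @[n --> \oo] --> f z) -> is_ps c f.
Proof.
move=> psf bnd cc cf; split=> [r r0|z].
  have [M csM] := bnd r r0; exists M => k.
  apply: (cvgr_to_le (cvgM (cvg_cabs_norm _ (cc k)) (cvg_cst (r ^+ k)))).
  by apply: nearW => n; exact: csM.
have [|M csM] := bnd (2 * cabs z); first by rewrite mulr_ge0 ?cabs_ge0.
have tail N : cabs (f z - \sum_(k < N) c k * z ^+ k) <= M * 2 / 2 ^+ N.
  have cvg_sum : (fun n => \sum_(k < N) cs n k * z ^+ k) @ \oo -->
      \sum_(k < N) c k * z ^+ k.
    apply: (cvg_sum_ord (fun n k => cs n k * z ^+ k) (fun k => c k * z ^+ k)) => k _.
    by apply: cvgM; [exact: cc|exact: cvg_cst].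
  apply: (@cabs_lim_le _ _ _ _ _ _ _ (cvgB (cf z) cvg_sum)); apply: nearW => n.
  exact: (ps_tail (psf n) (csM n)).
apply/cvg_cabs; apply: (@squeeze_cvgr _ _ _ _ (fun=> 0) (fun N => M * 2 / 2 ^+ N)).
- by apply: nearW => N; rewrite cabs_ge0 cabsB tail.
- exact: cvg_cst.
- exact: cvg_half.
Qed.

(** Derivatives at 0 of the partial products, built factor by factor: the exponential has the powers
    of [alpha] as derivatives, and [mulfac 0 1] is multiplication by z. *)
Fixpoint lag_coef (alpha : R) (l : nat) beta (N : nat) : nat -> R :=
  if N is N'.+1 then mulfac 1 (beta N') (lag_coef alpha l beta N')
  else iter l (mulfac 0 1) (GRing.exp alpha).

Lemma lag_coef_logcv alpha l beta N : 0 <= alpha -> (forall j, 0 <= beta j) ->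
  logcv (lag_coef alpha l beta N).
Proof.
move=> a0 b0; elim: N => [|N IH] /=; last exact: logcv_mulfac.
by elim: l => [|l IH] /=; [exact: logcv_exp|exact: logcv_mulfac].
Qed.

Lemma mulfac_ps p f (s b : R) : is_ps (fun k => rc (p k / k`!%:R)) f ->
  is_ps (fun k => rc (mulfac s b p k / k`!%:R)) (fun z => (rc s + rc b * z) * f z).
Proof.
move=> /(ps_mul_linear (rc s) (rc b)); congr is_ps; apply/funext => k.
by rewrite mulfac_coef rcD !rcM; case: k => [|k] //; rewrite rc0.
Qed.

Lemma lag_coef_ps alpha l beta N :
  is_ps (fun k => rc (lag_coef alpha l beta N k / k`!%:R))
   (fun z => z ^+ l * cexp (rc alpha * z) * \prod_(j < N) (1 + rc (beta j) * z)).
Proof.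
elim: N => [|N /(mulfac_ps 1 (beta N))] /=; last first.
  by congr is_ps; apply/funext => z; rewrite big_ord_recr /= mulrC mulrA rc1.
elim: l => [|l /(mulfac_ps 0 1)] /=; last first.
  by congr is_ps; apply/funext => z; rewrite !big_ord0 rc0 rc1 exprS; ring.
have := ps_dilate (rc alpha) (@cexp_ps R); congr is_ps; apply/funext => k.
  by rewrite rcM rcX rcV rc_nat mulrC.
by rewrite big_ord0 expr0; ring.
Qed.

Lemma prod1D_le beta (S : R) N : (forall j, 0 <= beta j) ->
  (forall n, \sum_(j < n) beta j <= S) -> \prod_(j < N) (1 + beta j) <= expR S.
Proof.
move=> b0 bS; apply: (@le_trans _ _ (expR (\sum_(j < N) beta j))); last first.
  by rewrite ler_expR.
elim: N => [|N IH]; first by rewrite !big_ord0 expR0.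
rewrite !big_ord_recr /= expRD ler_pM ?expR_ge1Dx //; last by rewrite addr_ge0.
by apply: prodr_ge0 => j _; rewrite addr_ge0.
Qed.

(** Each factor multiplies the bound by its value at [r]; majorising the product of the
    [1 + beta j * r] by an exponential removes the dependence on [N]. *)
Lemma lag_coef_le (alpha : R) l beta (S r : R) : 0 <= alpha -> (forall j, 0 <= beta j) ->
  (forall n, \sum_(j < n) beta j <= S) -> 0 <= r ->
  forall N k, lag_coef alpha l beta N k / k`!%:R * r ^+ k <=
    expR (S * r) * (r ^+ l * expR (alpha * r)).
Proof.
move=> a0 b0 bS r0 N k.
have b1 j : 0 <= beta j * r by rewrite mulr_ge0.
have rl0 : 0 <= r ^+ l * expR (alpha * r) by rewrite mulr_ge0 ?exprn_ge0 ?expR_ge0.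
apply: (@le_trans _ _ (\prod_(j < N) (1 + beta j * r) * (r ^+ l * expR (alpha * r)))).
  elim: N k => [|N IH] k /=.
    rewrite big_ord0 mul1r {rl0}; elim: l k => [|l IH] k /=.
      rewrite expr0 mul1r mulrAC -exprMn; apply: exp_term_le.
      by rewrite mulr_ge0.
    rewrite exprS -[r * _ * _]mulrA -[X in X * (_ * _)](mul1r r) -[1 * r]add0r.
    apply: mulfac_coef_le => //.
    by rewrite mulr_ge0 ?exprn_ge0 ?expR_ge0.
  rewrite big_ord_recr /= [_ * (1 + _)]mulrC -[_ * _ * (_ * _)]mulrA.
  apply: mulfac_coef_le => //.
  by rewrite mulr_ge0 // prodr_ge0 // => j _; rewrite addr_ge0.
rewrite ler_wpM2r //; apply: (@prod1D_le (fun j => beta j * r)) => // n.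
by rewrite -mulr_suml ler_wpM2r.
Qed.

(** A new factor adds a nonnegative amount to every coefficient, so the sequence is nondecreasing in
    [N]; [lag_coef_le] at radius 1 bounds it. *)
Lemma lag_coef_cvg alpha l beta (S : R) : 0 <= alpha -> (forall j, 0 <= beta j) ->
  (forall n, \sum_(j < n) beta j <= S) ->
  exists p, forall k, lag_coef alpha l beta N k @[N --> \oo] --> p k.
Proof.
move=> a0 b0 bS.
suff /choice[p pP] : forall k, exists x : R, lag_coef alpha l beta N k @[N --> \oo] --> x.
  by exists p.
move=> k; apply/cvg_ex; apply: nondecreasing_is_cvgn.
  apply/nondecreasing_seqP => N /=; rewrite /mulfac mul1r lerDl.
  by have [p0 _] := lag_coef_logcv l N a0 b0; rewrite !mulr_ge0.
exists (expR (S * 1) * (1 ^+ l * expR (alpha * 1)) * k`!%:R) => _ [N _ <-] /=.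
rewrite -ler_pdivrMr ?ltr0n ?fact_gt0 //.
by have := lag_coef_le l a0 b0 bS ler01 N k; rewrite [1 ^+ k]expr1n mulr1.
Qed.

(** [a] is the complex constant of the product and [p] the limit of [lag_coef]: log-concavity passes
    to this limit, and [ps_lim] identifies the sum of the series. *)
Lemma Laguerre_ps f : Laguerre f ->
  exists (a : C) p, logcv p /\ is_ps (fun k => a * rc (p k / k`!%:R)) f.
Proof.
move=> [a [l [alpha [beta [a0 _ b0 /cvg_ex[S bS] ff]]]]].
have bS' n : \sum_(j < n) beta j <= S.
  apply: (cvgr_to_ge bS); near=> m.
  have /subnKC <- : (n <= m)%N by near: m; exact: nbhs_infty_ge.
  by rewrite /series /= big_mkord big_split_ord /= lerDl sumr_ge0.
have [p cp] := lag_coef_cvg l a0 b0 bS'.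
exists a, p; split; first exact: logcv_lim (fun N => lag_coef_logcv l N a0 b0) cp.
apply: (ps_lim (fun N => ps_scale a (lag_coef_ps alpha l beta N))).
- move=> r r0; exists (cabs a * (expR (S * r) * (r ^+ l * expR (alpha * r)))) => N k.
  rewrite cabsM -mulrA ler_wpM2l ?cabs_ge0 // cabs_rc ger0_norm.
    exact: lag_coef_le.
  by have [p0 _] := lag_coef_logcv l N a0 b0; rewrite divr_ge0.
- move=> k; apply: cvgM; first exact: cvg_cst.
  by apply: cvg_rc; apply: cvgM; [exact: cp|exact: cvg_cst].
- move=> z; have := ff z.
  rewrite (_ : (fun N => _) = fun N => a * (z ^+ l * cexp (rc alpha * z) *
    \prod_(j < N) (1 + rc (beta j) * z))) //.
  by apply/funext => N; rewrite !mulrA.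
Unshelve. all: by end_near. Qed.

(** At a nonnegative point all terms are nonnegative multiples of the one number [a], so the partial
    sums grow in modulus. *)
Lemma ps_sum_le_at_radius a p f (r : R) N : (forall k, 0 <= p k) ->
  is_ps (fun k => a * rc (p k / k`!%:R)) f -> 0 <= r ->
  cabs a * \sum_(k < N) p k / k`!%:R * r ^+ k <= cabs (f (rc r)).
Proof.
move=> p0 [_ /(_ (rc r))/cvg_cabs_norm cf] r0.
apply: (cvgr_to_ge cf); near=> n.
rewrite (_ : \sum_(k < n) _ = a * rc (\sum_(k < n) p k / k`!%:R * r ^+ k)); last first.
  rewrite (rc_sum _ (fun k => p k / k`!%:R * r ^+ k)) mulr_sumr.
  by apply: eq_bigr => k _; rewrite [in RHS]rcM rcX mulrA.
have pos k : 0 <= p k / k`!%:R * r ^+ k by rewrite mulr_ge0 ?divr_ge0 ?exprn_ge0.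
rewrite cabsM cabs_rc ler_wpM2l ?cabs_ge0 // ger0_norm ?sumr_ge0 //.
have /subnKC <- : (N <= n)%N by near: n; exact: nbhs_infty_ge.
by rewrite big_split_ord /= lerDl sumr_ge0.
Unshelve. all: by end_near. Qed.

Lemma Laguerre_coef_le a p f (r : R) k : (forall k, 0 <= p k) ->
  is_ps (fun k => a * rc (p k / k`!%:R)) f -> 0 <= r ->
  cabs (a * rc (p k / k`!%:R)) * r ^+ k <= cabs (f (rc r)).
Proof.
move=> p0 cf r0; apply: le_trans (ps_sum_le_at_radius k.+1 p0 cf r0).
rewrite cabsM -mulrA ler_wpM2l ?cabs_ge0 // cabs_rc ger0_norm ?divr_ge0 //.
rewrite big_ord_recr /= lerDr sumr_ge0 // => i _.
by rewrite mulr_ge0 ?divr_ge0 ?exprn_ge0.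
Qed.

(** All coefficients are nonnegative multiples of [a], so the triangle inequality is an equality on
    the positive axis. *)
Lemma Laguerre_max_modulus f (r : R) (z : C) : Laguerre f -> cabs z <= r ->
  cabs (f z) <= cabs (f (rc r)).
Proof.
move=> /Laguerre_ps[a [p [[p0 _] cf]]] zr.
have r0 : 0 <= r := le_trans (cabs_ge0 z) zr.
apply: (@cabs_lim_le _ _ _ _ _ _ _ (proj2 cf z)); apply: nearW => N.
apply: le_trans (ps_sum_le_at_radius N p0 cf r0).
apply: le_trans (cabs_sum _ _ _) _; rewrite mulr_sumr; apply: ler_sum => k _.
rewrite !cabsM cabs_rc cabsX ger0_norm ?divr_ge0 // -mulrA.
rewrite ler_wpM2l ?cabs_ge0 // ler_wpM2l ?divr_ge0 //.
by rewrite lerXn2r ?nnegrE ?cabs_ge0.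
Qed.

End LaguerreSeries.

(** * Geometric bounds for log-concave sequences *)

Section RealBounds.
Variable R : realType.
Implicit Types (u e : nat -> R) (b M : R).

Lemma le_sum_norm u N n : (n < N)%N -> u n <= \sum_(i < N) `|u i|.
Proof.
move=> nN; rewrite (bigD1 (Ordinal nN)) //=.
by apply: le_trans (ler_norm _) _; rewrite lerDl sumr_ge0.
Qed.

Lemma eventually_ub u M : (\forall n \near \oo, u n <= M) -> exists M', forall n, u n <= M'.
Proof.
move=> [N _ uM]; exists (`|M| + \sum_(i < N) `|u i|) => n.
case: (ltnP n N) => nN.
  by apply: le_trans (le_sum_norm u nN) _; rewrite lerDr.
by apply: le_trans (uM _ nN) (le_trans (ler_norm _) _); rewrite lerDl sumr_ge0.
Qed.

Lemma cvg_ub u (l : R) : u @ \oo --> l -> exists M, forall n, u n <= M.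
Proof.
move=> ul; apply: (@eventually_ub _ (l + 1)).
by apply: (cvgr_le _ ul); rewrite ltrDl.
Qed.

(** Log-concavity compares the ratio at [k + j] with the one at [k]. It is used in product form,
    since later terms may vanish. *)
Lemma logcv_tail_le e k b : logcv e -> 0 < e k -> e k.+1 <= b * e k -> 0 <= b ->
  forall j, e (k + j)%N <= b ^+ j * e k.
Proof.
move=> [e0 eL] ek eb b0; elim=> [|j IH]; first by rewrite addn0 mul1r.
rewrite addnS exprS -mulrA; apply: le_trans (ler_wpM2l b0 IH).
rewrite -(ler_pM2l ek); apply: le_trans (eL _ _ (leq_addr j k)) _.
by apply: le_trans (ler_wpM2r (e0 _) eb) _; rewrite mulrA [e k * b]mulrC.
Qed.

Lemma cvg_ratio_exp0 b (b' M : R) : 0 <= b' -> b' < b -> M * (b' / b) ^+ n @[n --> \oo] --> (0 : R).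
Proof.
move=> b0 bb; apply: cvg_geometric; have b1 : 0 < b by exact: le_lt_trans bb.
by rewrite ger0_norm ?divr_ge0 ?(ltW b1) // ltr_pdivrMr // mul1r.
Qed.

(** Otherwise every step from [l] on multiplies [e] by at least [b], and growth like [b ^+ j]
    contradicts the bound with [b' < b]. *)
Lemma exists_small_ratio e b (b' M : R) l : 0 <= b' -> b' < b -> 0 < e l ->
  (forall k, e k <= M * b' ^+ k) -> exists k, 0 < e k /\ e k.+1 < b * e k.
Proof.
move=> b0 bb el eM; apply: contrapT => nex.
have b1 : 0 < b by exact: le_lt_trans bb.
have grow j : b ^+ j * e l <= e (l + j)%N.
  elim: j => [|j IH]; first by rewrite mul1r addn0.
  have ej : 0 < e (l + j)%N by apply: lt_le_trans IH; rewrite mulr_gt0 ?exprn_gt0.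
  rewrite addnS exprS -mulrA; apply: le_trans (ler_wpM2l (ltW b1) IH) _.
  by rewrite leNgt; apply/negP => ?; apply: nex; exists (l + j)%N.
suff : e l <= 0 by rewrite leNgt el.
apply: (cvgr_to_ge (cvg_ratio_exp0 (M * b' ^+ l) b0 bb)); apply: nearW => j.
rewrite exprMn exprVn mulrA ler_pdivlMr ?exprn_gt0 // mulrC.
by apply: le_trans (grow j) (le_trans (eM _) _); rewrite exprD mulrA.
Qed.

(** A ratio of [e] strictly below [b] remains so for [es n] with [n] large, and log-concavity then
    controls all later indices. The earlier indices are bounded by convergence, the remaining
    finitely many [n] by their own bounds. *)
Lemma logcv_uniform_bound (es : nat -> nat -> R) e l (a : R) : 0 <= a ->
  (forall n, logcv (es n)) -> (forall k, es n k @[n --> \oo] --> e k) -> 0 < e l ->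
  (forall b, a < b -> exists M, forall k, e k <= M * b ^+ k) ->
  (forall n b, a < b -> exists M, forall k, es n k <= M * b ^+ k) ->
  forall b, a < b -> exists M, forall n k, es n k <= M * b ^+ k.
Proof.
move=> a0 esL ce el eM esM b ab.
have b0 : 0 < b by exact: le_lt_trans ab.
(* A bound on [e] at the midpoint leaves the gap below [b] that [exists_small_ratio] needs. *)
have aab : a < (a + b) / 2 by lra.
have abb : (a + b) / 2 < b by lra.
have [M0 eM0] := eM _ aab.
have [k0 [ek0 ek1]] := exists_small_ratio (le_trans a0 (ltW aab)) abb el eM0.
have /choice[B BP] : forall k, exists B, forall n, es n k <= B.
  by move=> k; exact: cvg_ub (ce k).
pose M1 : R := \sum_(k < k0.+1) `|B k / b ^+ k|.
have M1P n k : (k <= k0)%N -> es n k <= M1 * b ^+ k.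
  move=> kk0; rewrite -ler_pdivrMr ?exprn_gt0 //.
  apply: le_trans (@le_sum_norm (fun k => B k / b ^+ k) k0.+1 k kk0).
  by apply: ler_wpM2r (BP k n); rewrite invr_ge0 exprn_ge0 // ltW.
have near_bnd : \forall n \near \oo, forall k, es n k <= M1 * b ^+ k.
  near=> n.
  have en0 : 0 < es n k0 by near: n; apply: (cvgr_gt _ (ce k0)).
  have en1 : es n k0.+1 <= b * es n k0.
    rewrite -subr_ge0; near: n.
    have cvg_diff : b * es n k0 - es n k0.+1 @[n --> \oo] --> b * e k0 - e k0.+1.
      by apply: cvgB; [apply: cvgM; [exact: cvg_cst|exact: ce]|exact: ce].
    by apply: (cvgr_ge _ cvg_diff); rewrite subr_gt0.
  move=> k; case: (leqP k k0) => [|/ltnW/subnKC <-]; first exact: M1P.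
  move: (k - k0)%N => j.
  apply: le_trans (logcv_tail_le (esL n) en0 en1 (ltW b0) j) _.
  rewrite exprD mulrA mulrC ler_wpM2r ?exprn_ge0 ?(ltW b0) //.
  exact: M1P.
have /choice[Mn MnP] : forall n, exists M, forall k, es n k <= M * b ^+ k.
  by move=> n; exact: esM.
case: near_bnd => N _ NP; exists (M1 + \sum_(n < N) `|Mn n|) => n k.
have M10 : 0 <= M1 by exact: sumr_ge0.
have S0 : 0 <= \sum_(n < N) `|Mn n| by exact: sumr_ge0.
have bk : 0 <= b ^+ k by rewrite exprn_ge0 ?ltW.
case: (ltnP n N) => nN.
  apply: le_trans (MnP n k) _; rewrite ler_wpM2r //.
  by apply: le_trans (le_sum_norm Mn nN) _; rewrite lerDr.
by apply: le_trans (NP _ nN k) _; rewrite ler_wpM2r // lerDl.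
Unshelve. all: by end_near. Qed.

End RealBounds.

(** * From pointwise convergence to convergence of coefficients *)

Section CoefficientConvergence.
Variable R : realType.
Local Notation C := (CC R).
Implicit Types (c : nat -> C) (f : C -> C).

Lemma ps_remainder c f (M x : R) k : is_ps c f -> (forall i, cabs (c i) <= M) ->
  0 <= x -> x <= 2^-1 ->
  cabs (f (rc x) - \sum_(i < k) c i * rc x ^+ i) <= M * x ^+ k * 2.
Proof.
move=> [_ cf] cM x0 x1.
have cvg_rem : (fun n => \sum_(i < n) c i * rc x ^+ i - \sum_(i < k) c i * rc x ^+ i) @ \oo -->
    f (rc x) - \sum_(i < k) c i * rc x ^+ i.
  exact: cvgB (cf _) (cvg_cst _).
apply: (@cabs_lim_le _ _ _ _ _ _ _ cvg_rem); near=> n.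
have /subnKC <- : (k <= n)%N by near: n; exact: nbhs_infty_ge.
rewrite big_split_ord /= [X in X - _]addrC addrK.
have := @dominated_sum_le R (fun j => c (k + j)%N * rc x ^+ (k + j))
  (M * x ^+ k) _ 0%N (n - k)%N isT.
rewrite big_ord0 subr0 expr0 divr1; apply=> j.
rewrite cabsM cabsX cabs_rc ger0_norm // exprD mulrA.
apply: ler_pM; rewrite ?mulr_ge0 ?exprn_ge0 ?cabs_ge0 //.
  by rewrite ler_wpM2r ?exprn_ge0.
by rewrite -exprVn lerXn2r ?nnegrE ?invr_ge0.
Unshelve. all: by end_near. Qed.

(** Strong induction on [k]: at a fixed small [x > 0] the term of index [k] is the value of [gs n]
    minus the lower terms, all tending to 0, up to a remainder of order x^(k+1). Division by x^k
    leaves the error [2 * M * x]. *)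
Lemma coef_cvg0 (ds : nat -> nat -> C) (gs : nat -> C -> C) (M : R) :
  (forall n, is_ps (ds n) (gs n)) -> (forall n k, cabs (ds n k) <= M) ->
  (forall z, cabs (gs n z) @[n --> \oo] --> (0 : R)) ->
  forall k, cabs (ds n k) @[n --> \oo] --> (0 : R).
Proof.
move=> psd dM g0; elim/ltn_ind => k IH; apply/cvgr0Pnorm_lt => e e0.
have M0 : 0 <= M := le_trans (cabs_ge0 _) (dM 0%N 0%N).
(* In the denominator, [2 * e] ensures [x <= 2^-1] and [4 * (M + 1)] ensures [2 * M * x < e / 2]. *)
pose x := e / (4 * (M + 1) + 2 * e).
have den0 : 0 < 4 * (M + 1) + 2 * e by lra.
have x0 : 0 < x by rewrite divr_gt0.
have x1 : x <= 2^-1 by rewrite ler_pdivrMr //; lra.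
have x2 : 2 * M * x < e / 2.
  by rewrite mulrA ltr_pdivrMr //; nra.
have xk : 0 < x ^+ k by exact: exprn_gt0.
pose A n := (cabs (gs n (rc x)) + \sum_(i < k) cabs (ds n i) * x ^+ i) / x ^+ k.
have A0 : A n @[n --> \oo] --> (0 : R).
  have -> : (0 : R) = (0 + \sum_(i < k) 0) / x ^+ k by rewrite big1 // addr0 mul0r.
  apply: cvgM; last exact: cvg_cst.
  apply: cvgD; first exact: g0.
  apply: (cvg_sum_ord (fun n i => cabs (ds n i) * x ^+ i : R^o) (fun=> 0)) => i ik.
  by rewrite -[X in _ --> X](mul0r (x ^+ i)); apply: cvgM; [exact: IH|exact: cvg_cst].
move/cvgr0Pnorm_lt: A0 => /(_ (e / 2)); rewrite divr_gt0 // => /(_ isT).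
apply: filterS => n An; rewrite ger0_norm ?cabs_ge0 //.
suff : cabs (ds n k) <= A n + 2 * M * x.
  by have := ler_norm (A n); lra.
have rem := ps_remainder k.+1 (psd n) (dM n) (ltW x0) x1.
rewrite -(ler_pM2r xk) mulrDl divfK ?gt_eqF //.
have -> : cabs (ds n k) * x ^+ k = cabs (ds n k * rc x ^+ k).
  by rewrite cabsM cabsX cabs_rc ger0_norm // ltW.
rewrite big_ord_recr /= in rem.
have -> : ds n k * rc x ^+ k = gs n (rc x) - \sum_(i < k) ds n i * rc x ^+ i
   - (gs n (rc x) - (\sum_(i < k) ds n i * rc x ^+ i + ds n k * rc x ^+ k)).
  by ring.
apply: le_trans (cabsD _ _) _; apply: lerD.
  apply: le_trans (cabsD _ _) _; rewrite cabsN lerD2l.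
  apply: le_trans (cabs_sum _ _ _) _; apply: ler_sum => i _.
  by rewrite cabsM cabsX cabs_rc ger0_norm // ltW.
by rewrite cabsN; apply: le_trans rem _; rewrite exprS; lra.
Qed.

Lemma coef_cvg (cs : nat -> nat -> C) (fs : nat -> C -> C) c f (M : R) :
  (forall n, is_ps (cs n) (fs n)) -> is_ps c f -> (forall n k, cabs (cs n k) <= M) ->
  (forall z, fs n z @[n --> \oo] --> f z) ->
  forall k, cs n k @[n --> \oo] --> c k.
Proof.
move=> psc pc cM cf k; apply/cvg_cabs.
have [M' cM'] := proj1 pc 1 ler01.
apply: (@coef_cvg0 (fun n k => cs n k - c k) (fun n z => fs n z - f z) (M + M')).
- by move=> n; exact: (ps_sub (psc n) pc).
- move=> n i; apply: le_trans (cabsD _ _) _; rewrite cabsN lerD //.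
  by have := cM' i; rewrite expr1n mulr1.
- by move=> z; apply/cvg_cabs; exact: cf.
Qed.

End CoefficientConvergence.

(** * Re-centred product representation *)

Section NormalForm.
Variable R : realType.
Local Notation C := (CC R).
Implicit Types (t x : nat -> R) (f : C -> C) (w z : C).

Lemma nonneg_sum_cvg t (S : R) : (forall j, 0 <= t j) ->
  (forall n, \sum_(j < n) t j <= S) ->
  exists T, [/\ (fun n => \sum_(j < n) t j) @ \oo --> T, T <= S &
    forall n, \sum_(j < n) t j <= T].
Proof.
move=> t0 tS.
have nd : nondecreasing_seq (fun n => \sum_(j < n) t j).
  by apply/nondecreasing_seqP => n; rewrite big_ord_recr /= lerDl.
have /cvg_ex[T tT] : cvgn (fun n => \sum_(j < n) t j).
  by apply: nondecreasing_is_cvgn => //; exists S => _ [n _ <-].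
exists T; split => //.
  by apply: (cvgr_to_le tT); apply: nearW.
move=> n; apply: (cvgr_to_ge tT); near=> m; apply: nd.
by near: m; exact: nbhs_infty_ge.
Unshelve. all: by end_near. Qed.

Lemma prod1D_cvg x (S : R) : (forall j, 0 <= x j) ->
  (forall n, \sum_(j < n) x j <= S) ->
  exists Q : R, Q != 0 /\ (fun N => \prod_(j < N) (1 + x j)) @ \oo --> Q.
Proof.
move=> x0 xS.
have prod_ge1 N : 1 <= \prod_(j < N) (1 + x j).
  elim: N => [|N IH]; first by rewrite big_ord0.
  by rewrite big_ord_recr /= -[1 in X in X <= _]mulr1 ler_pM // lerDl.
have /cvg_ex[Q xQ] : cvgn (fun n => \prod_(j < n) (1 + x j)).
  apply: nondecreasing_is_cvgn.
    apply/nondecreasing_seqP => N; rewrite big_ord_recr /= ler_peMr ?lerDl //.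
    by apply: le_trans (prod_ge1 N).
  by exists (expR S) => _ [n _ <-]; exact: prod1D_le.
exists Q; split => //; rewrite gt_eqF // (lt_le_trans ltr01) //.
by apply: (cvgr_to_ge xQ); exact: nearW.
Qed.

(* [t j] stands for [r b / (1 + r b)] where [- 1/b] is a zero of [f]; zeros at
   the origin have [t j = 1]. *)
Definition normal_form (r : R) f (alpha T : R) t :=
  [/\ 0 <= alpha, (forall j, t j.+1 <= t j), (forall j, 0 <= t j <= 1),
      (fun N => \sum_(j < N) t j) @ \oo --> T &
      forall w, (fun N => f (rc r) * (cexp (rc alpha * w)
        * \prod_(j < N) (1 + rc (t j) * w))) @ \oo --> f (rc r * (1 + w))].

(** For t = x / (1 + x) one has (1 + x) (1 + t w) = 1 + x (1 + w); the indices below [l] contribute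
    [1 + w] each. *)
Lemma prod_normalize x t l N w : (forall j, 0 <= x j) ->
  (forall j, (j < l)%N -> t j = 1) -> (forall j, t (l + j)%N = x j / (1 + x j)) ->
  rc (\prod_(j < N) (1 + x j)) * \prod_(j < l + N) (1 + rc (t j) * w) =
  (1 + w) ^+ l * \prod_(j < N) (1 + rc (x j) * (1 + w)).
Proof.
move=> x0 t1 tx; rewrite big_split_ord /= mulrCA; congr (_ * _).
  rewrite (eq_bigr (fun=> 1 + w)); first by rewrite prodr_const card_ord.
  by move=> j _; rewrite t1 ?rc1 ?mul1r //; exact: ltn_ord.
rewrite (rc_prod _ (fun j => 1 + x j)) -big_split /=; apply: eq_bigr => j _.
have x1 : 1 + x j != 0 by rewrite gt_eqF // (lt_le_trans ltr01) // lerDl.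
by rewrite tx mulrDr mulr1 mulrA -rcM [(1 + x j) * _]mulrC divfK // rcD rc1; ring.
Qed.

Lemma decreasing_le t : (forall j, t j.+1 <= t j) -> forall i j, (i <= j)%N -> t j <= t i.
Proof.
move=> td i j /subnKC <-; elim: (j - i)%N => [|m IH]; first by rewrite addn0.
by rewrite addnS; apply: le_trans (td _) IH.
Qed.

Lemma Laguerre_normal_form (r : R) f : 0 < r -> Laguerre f ->
  exists alpha T t, normal_form r f alpha T t.
Proof.
move=> r0 [a [l [alpha [beta [a0 bd b0 /cvg_ex[S bS] ff]]]]].
pose x j := beta j * r.
have x0 j : 0 <= x j by rewrite mulr_ge0 // ltW.
have bS' n : \sum_(j < n) x j <= S * r.
  rewrite -mulr_suml ler_wpM2r ?(ltW r0) //.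
  apply: (cvgr_to_ge bS); near=> m.
  have /subnKC <- : (n <= m)%N by near: m; exact: nbhs_infty_ge.
  by rewrite /series /= big_mkord big_split_ord /= lerDl sumr_ge0.
(* The first [l] weights stand for the factor z^l. *)
pose t j := if (j < l)%N then 1 else x (j - l)%N / (1 + x (j - l)%N).
have tl j : (j < l)%N -> t j = 1 by rewrite /t => ->.
have tx j : t (l + j)%N = x j / (1 + x j) by rewrite /t ltnNge leq_addr /= addKn.
have xpos j : 0 < 1 + x j by rewrite (lt_le_trans ltr01) // lerDl.
have t01 j : 0 <= t j <= 1.
  rewrite /t; case: ifP => _; first by rewrite ler01 lexx.
  rewrite divr_ge0 ?(ltW (xpos _)) //= ler_pdivrMr // mul1r.
  by rewrite lerDr ler01.
have td j : t j.+1 <= t j.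
  case: (ltnP j l) => jl; first by rewrite (tl j jl); have /andP[] := t01 j.+1.
  rewrite -(subnKC jl) -addnS !tx ler_pdivrMr // mulrAC ler_pdivlMr //.
  rewrite !mulrDr !mulr1 [x _ * x _]mulrC lerD2r.
  by rewrite ler_wpM2r ?(ltW r0).
have tS n : \sum_(j < n) t j <= l%:R + S * r.
  apply: (@le_trans _ _ (\sum_(j < l + n) t j)).
    rewrite addnC big_split_ord /= lerDl sumr_ge0 // => j _.
    by have /andP[] := t01 (n + j)%N.
  rewrite big_split_ord /= lerD //.
    rewrite (eq_bigr (fun=> 1)); first by rewrite sumr_const card_ord.
    by move=> j _; rewrite tl.
  apply: le_trans (bS' n); apply: ler_sum => j _; rewrite tx ler_pdivrMr //.
  by rewrite ler_peMr // lerDl.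
have t0 j : 0 <= t j by have /andP[] := t01 j.
have [T [tT _ _]] := nonneg_sum_cvg t0 tS.
have [Q [Q0 xQ]] := prod1D_cvg x0 bS'.
exists (alpha * r), T, t.
split; [by rewrite mulr_ge0 // ltW|exact: td|exact: t01|exact: tT|].
(* Evaluation at [r] expresses the constant of the normal form through [a] and the infinite product
   [Q]. *)
have fr : f (rc r) = a * rc r ^+ l * cexp (rc alpha * rc r) * rc Q.
  apply: (limC_unique (ff (rc r))).
  rewrite (_ : (fun N => _) = fun N => a * rc r ^+ l * cexp (rc alpha * rc r) *
     rc (\prod_(j < N) (1 + x j))).
    by apply: cvgM; [exact: cvg_cst|exact: cvg_rc xQ].
  apply/funext => N; rewrite (rc_prod _ (fun j => 1 + x j)); congr (_ * _).
  by apply: eq_bigr => j _; rewrite rcD rcM.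
move=> w; pose g N := f (rc r) * (cexp (rc (alpha * r) * w)
  * \prod_(j < N) (1 + rc (t j) * w)).
(* A product over [l + N] weights corresponds to [N] factors of the original product. *)
suff : (fun N => g (N + l)%N) @ \oo --> f (rc r * (1 + w)) by rewrite (cvg_shiftn l g).
have QN0 N : rc (\prod_(j < N) (1 + x j)) != 0 :> C.
  by rewrite -rc0 (inj_eq (@rc_inj R)); apply/prodf_neq0 => j _; rewrite gt_eqF.
(* [f (rc r)] contains the whole product [Q], while the truncation contains [N] of its factors;
   their quotient tends to 1. *)
rewrite (_ : (fun N => _) = fun N => (a * (rc r * (1 + w)) ^+ l * cexp (rc alpha * (rc r * (1 + w)))
   * \prod_(j < N) (1 + rc (beta j) * (rc r * (1 + w))))
   * (rc Q * (rc (\prod_(j < N) (1 + x j)))^-1)); last first.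
  apply/funext => N; apply: (mulfI (QN0 N)); rewrite /g addnC.
  have -> : rc (alpha * r) * w = rc alpha * (rc r * (1 + w)) - rc alpha * rc r.
    by rewrite rcM; ring.
  set z := rc r * (1 + w).
  have pn := prod_normalize N w x0 tl tx.
  have px : \prod_(j < N) (1 + rc (x j) * (1 + w)) = \prod_(j < N) (1 + rc (beta j) * z).
    by apply: eq_bigr => j _; rewrite /x rcM mulrA.
  rewrite px in pn.
  rewrite [RHS]mulrCA [_ * (rc Q * _)]mulrCA mulfV // mulr1.
  transitivity (f (rc r) * cexp (rc alpha * z - rc alpha * rc r) *
      (rc (\prod_(j < N) (1 + x j)) * \prod_(j < l + N) (1 + rc (t j) * w))).
    by move: (rc _) (\prod_(j < l + N) _) => *; ring.
  rewrite pn fr cexpD [z ^+ l]exprMn.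
  have := cexpN (rc alpha * rc r).
  move: (cexp (- (rc alpha * rc r))) (cexp (rc alpha * rc r)) (cexp (rc alpha * z)) => e1 e2 e3.
  move: (\prod_(j < N) (1 + rc (beta j) * z)) => P e12.
  transitivity ((e1 * e2) * (a * (rc r ^+ l * (1 + w) ^+ l) * e3 * P * rc Q)); first by ring.
  by rewrite e12 mul1r.
have -> : f (rc r * (1 + w)) = f (rc r * (1 + w)) * (rc Q / rc Q).
  by rewrite divff ?mulr1 // -rc0 (inj_eq (@rc_inj R)).
apply: cvgM; first exact: ff.
apply: cvgM; first exact: cvg_cst.
apply: cvgV; last exact: cvg_rc xQ.
by rewrite -rc0 (inj_eq (@rc_inj R)).
Unshelve. all: by end_near. Qed.

(** Weights equal to 1 give back the power of z; the others are inverted by x = t / (1 - t). *)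
Lemma normal_form_Laguerre (r : R) f alpha T t : 0 < r ->
  normal_form r f alpha T t -> Laguerre f.
Proof.
move=> r0 [a0 td t01 tT ff].
have t0 j : 0 <= t j by have /andP[] := t01 j.
(* Summable weights tend to 0, so only finitely many equal 1; [l] is their number. *)
have [l tl lmin] : exists2 l, t l < 1 & forall j, (j < l)%N -> t j = 1.
  have exl : exists l, t l < 1.
    have t_cvg0 : t @ \oo --> (0 : R).
      apply: cvg_series_cvg_0; apply/cvg_ex; exists T; move: tT.
      rewrite (_ : (fun N => _) = series t) //.
      by apply/funext => N; rewrite /series /= big_mkord.
    have [N _ NP] := cvgr_lt _ t_cvg0 _ ltr01.
    by exists N; exact: NP (leqnn _).
  case: (ex_minnP exl) => l tl lmin; exists l => // j jl.
  have /andP[_ tj1] := t01 j; apply/eqP; rewrite eq_le tj1 leNgt.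
  by apply/negP => /lmin; rewrite leqNgt jl.
pose x j := t (l + j)%N / (1 - t (l + j)%N).
have t1 j : t (l + j)%N < 1 by apply: le_lt_trans tl; apply: decreasing_le => //; exact: leq_addr.
have d0 j : 0 < 1 - t (l + j)%N by rewrite subr_gt0.
have x0 j : 0 <= x j by rewrite divr_ge0 // ltW.
have x1E j : 1 + x j = (1 - t (l + j)%N)^-1.
  by rewrite /x -[X in X + _](divff (lt0r_neq0 (d0 j))) -mulrDl subrK mul1r.
have tx j : t (l + j)%N = x j / (1 + x j).
  by rewrite x1E invrK /x divfK // lt0r_neq0.
have xd j : x j.+1 <= x j.
  rewrite /x addnS ler_pM ?invr_ge0 ?(ltW (d0 _)) //.
    by have := d0 j.+1; rewrite addnS => /ltW.
  rewrite lef_pV2 ?posrE //; last by have := d0 j.+1; rewrite addnS.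
  by rewrite lerD2l lerN2.
(* As [t] decreases, all denominators of the [x j] are at least [1 - t l], so summability passes
   from [t] to [x]. *)
have xS n : \sum_(j < n) x j <= T / (1 - t l).
  apply: (@le_trans _ _ (\sum_(j < n) t (l + j)%N / (1 - t l))).
    apply: ler_sum => j _; rewrite ler_wpM2l // lef_pV2 ?posrE ?subr_gt0 //.
    by rewrite lerD2l lerN2; apply: decreasing_le => //; exact: leq_addr.
  rewrite -mulr_suml ler_wpM2r ?invr_ge0 ?subr_ge0 ?(ltW tl) //.
  apply: (cvgr_to_ge tT); near=> m.
  have /subnKC <- : (l + n <= m)%N by near: m; exact: nbhs_infty_ge.
  rewrite !big_split_ord /= -addrA addrCA lerDl addr_ge0 ?sumr_ge0 //.
have [Q [Q0 xQ]] := prod1D_cvg x0 xS.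
have [X [xX _ _]] := nonneg_sum_cvg x0 xS.
have rn0 : r != 0 by rewrite gt_eqF.
(* The constant c solves f(r) = c r^l e^alpha Q; dividing [alpha] and [x j] by [r] undoes the
   scaling in w = z / r - 1. *)
exists (f (rc r) * cexp (- rc alpha) / rc Q / rc r ^+ l), l, (alpha / r), (fun j => x j / r).
split.
- by rewrite divr_ge0 // ltW.
- by move=> j; rewrite ler_wpM2r // invr_ge0 ltW.
- by move=> j; rewrite divr_ge0 // ltW.
- apply/cvg_ex; exists (X / r).
  rewrite (_ : series _ = fun n => (\sum_(j < n) x j) / r).
    by apply: cvgM; [exact: xX|exact: cvg_cst].
  by apply/funext => n; rewrite /series /= big_mkord mulr_suml.
move=> z; pose w := z / rc r - 1.
have rc_neq0 (y : R) : y != 0 -> rc y != 0 :> C by rewrite -rc0 (inj_eq (@rc_inj R)).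
have zw : z = rc r * (1 + w) by rewrite /w addrC subrK mulrC divfK // rc_neq0.
have := ff w; rewrite -zw => /(cvg_comp _ _ (cvg_addnl l)) /= fw.
have -> : f z = f z * (rc Q / rc Q) by rewrite divff ?mulr1 // rc_neq0.
rewrite [X in X @ _ --> _](_ : _ = fun N => (f (rc r) * (cexp (rc alpha * w) *
    \prod_(j < l + N) (1 + rc (t j) * w))) * (rc (\prod_(j < N) (1 + x j)) / rc Q)).
  apply: cvgM; first exact: fw.
  by apply: cvgM; [exact: cvg_rc xQ|exact: cvg_cst].
apply/funext => N; have pn := prod_normalize N w x0 lmin tx.
rewrite -/(rc _) (_ : rc (alpha / r) * z = rc alpha + rc alpha * w); last first.
  by rewrite zw rcM rcV -mulrA mulKf ?rc_neq0 // mulrDr mulr1.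
rewrite [X in _ * X](eq_bigr (fun j : 'I_N => 1 + rc (x j) * (1 + w))); last first.
  by move=> j _; rewrite -/(rc _) zw rcM rcV -mulrA mulKf ?rc_neq0.
transitivity (f (rc r) * cexp (rc alpha * w) *
    (rc (\prod_(j < N) (1 + x j)) * \prod_(j < l + N) (1 + rc (t j) * w)) / rc Q); last first.
  by move: (rc (\prod_(j < N) _)) (\prod_(j < l + N) _) (rc Q)^-1 => *; ring.
rewrite pn cexpD {1}zw exprMn.
have rl1 : (rc r ^+ l)^-1 * rc r ^+ l = 1 by rewrite mulVf // expf_neq0 // rc_neq0.
have := cexpN (rc alpha).
move: (cexp (- rc alpha)) (cexp (rc alpha)) (cexp (rc alpha * w)) => e1 e2 e3 e12.
move: (\prod_(j < N) (1 + rc (x j) * (1 + w))) (rc Q)^-1 => P i3.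
move: rl1; move: (rc r ^+ l) => i2 i12.
transitivity ((e1 * e2) * (i2^-1 * i2) * (f (rc r) * e3 * ((1 + w) ^+ l * P) * i3)); first by ring.
by rewrite e12 i12 !mul1r.
Unshelve. all: by end_near. Qed.

End NormalForm.

(** * Closure of the Laguerre class under limits *)

Section Closure.
Variable R : realType.
Local Notation C := (CC R).
Implicit Types (t : nat -> R) (f : C -> C) (w z : C).

(** Compactness of the interval gives a cluster point, and a cluster point of an ultrafilter is a
    limit. *)
Lemma ultra_cvg (U : set_system nat) (u : nat -> R) (B : R) : UltraFilter U ->
  (\forall n \near U, 0 <= u n <= B) -> exists l : R, u @ U --> l.
Proof.
move=> ultraU uB.
have [|l [_ lcl]] := @segment_compact R 0 B (u @ U) _.
  by move: uB; apply: filterS => n; rewrite /= in_itv.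
exists l => V /= lV; have [//|notV] := in_ultra_setVsetC (u @^-1` V) ultraU.
by have [y [/= nVy Vy]] := lcl (~` V) V notV lV.
Qed.

Lemma cvg_prod_ord (T : Type) (F : set_system T) (FF : Filter F)
    (u : T -> nat -> C) (l : nat -> C) N :
  (forall k, u s k @[s --> F] --> l k) ->
  \prod_(k < N) u s k @[s --> F] --> \prod_(k < N) l k.
Proof.
move=> ul; elim: N => [|N IH].
  by rewrite big_ord0; under eq_fun do rewrite big_ord0; exact: cvg_cst.
rewrite big_ord_recr /=; under eq_fun do rewrite big_ord_recr /=.
exact: cvgM IH (ul N).
Qed.

(* The factors beyond [J] are replaced by exponentials with the same total weight [S]. *)
Definition genus_approx t (S : R) (J : nat) w : C :=
  \prod_(j < J) (1 + rc (t j) * w) * cexp (rc (S - \sum_(j < J) t j) * w).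

Definition weights t (S : R) := [/\ (forall j, t j.+1 <= t j), (forall j, 0 <= t j) &
  forall n, \sum_(j < n) t j <= S].

(** The J + 1 weights up to index [J] are all at least [t J]. *)
Lemma weights_le t S J : weights t S -> t J <= S / J.+1%:R.
Proof.
move=> [td t0 tS]; rewrite ler_pdivlMr ?ltr0n // mulr_natr.
apply: le_trans (tS J.+1); rewrite -[X in _ *+ X](card_ord J.+1) -sumr_const.
by apply: ler_sum => j _; apply: decreasing_le => //; rewrite -ltnS ltn_ord.
Qed.

(** The two approximants differ by trading [1 + rc (t J) * w] for its exponential, a second-order
    error by [cabs_cexpB1z]. The other factors are bounded by exponentials, and the exponents add up
    to [S * cabs w]. *)
Lemma genus_approx_step t S J w : weights t S ->
  cabs (genus_approx t S J.+1 w - genus_approx t S J w) <=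
  expR (S * cabs w) * cabs w ^+ 2 * t J ^+ 2.
Proof.
move=> [_ t0 tS]; rewrite /genus_approx; set s := S - \sum_(j < J.+1) t j.
have s0 : 0 <= s by rewrite subr_ge0.
have -> : S - \sum_(j < J) t j = s + t J by rewrite /s big_ord_recr /=; ring.
rewrite big_ord_recr /= rcD mulrDl cexpD.
set P := \prod_(j < J) _; set E := cexp (rc s * w).
have -> : P * (1 + rc (t J) * w) * E - P * (E * cexp (rc (t J) * w)) =
    - (P * E * (cexp (rc (t J) * w) - (1 + rc (t J) * w))) by ring.
rewrite cabsN 2!cabsM.
have w0 := cabs_ge0 w.
have PE : cabs P <= expR ((\sum_(j < J) t j) * cabs w).
  rewrite cabs_prod; apply: (@le_trans _ _ (\prod_(j < J) (1 + t j * cabs w))).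
    apply: ler_prod => j _; rewrite cabs_ge0 /=.
    by apply: le_trans (cabsD _ _) _; rewrite cabs1 cabsM cabs_rc ger0_norm.
  rewrite mulr_suml; elim: {P E s s0} J => [|J IH]; first by rewrite !big_ord0 expR0.
  rewrite !big_ord_recr /= expRD ler_pM ?expR_ge1Dx //.
    by apply: prodr_ge0 => j _; rewrite addr_ge0 ?mulr_ge0.
  by rewrite addr_ge0 ?mulr_ge0.
have EE : cabs E <= expR (s * cabs w).
  by apply: le_trans (cabs_cexp _) _; rewrite cabsM cabs_rc ger0_norm.
have LE := cabs_cexpB1z (rc (t J) * w); rewrite cabsM cabs_rc ger0_norm // in LE.
have -> : S * cabs w = (\sum_(j < J) t j) * cabs w + s * cabs w + t J * cabs w.
  by rewrite /s big_ord_recr /=; ring.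
rewrite !expRD.
have := ler_pM (mulr_ge0 (cabs_ge0 P) (cabs_ge0 E)) (cabs_ge0 _)
  (ler_pM (cabs_ge0 P) (cabs_ge0 E) PE EE) LE.
move/le_trans; apply; rewrite exprMn le_eqVlt; apply/orP; left; apply/eqP; ring.
Qed.

(** Telescoping leaves the sum of the squares of the weights from [J] on, at most [S / J.+1%:R]
    times their sum. The bound depends on the weights only through [S], hence is uniform along a
    sequence with bounded [S]. *)
Lemma genus_approx_dist t S J N w : weights t S -> (J <= N)%N ->
  cabs (genus_approx t S N w - genus_approx t S J w) <=
  expR (S * cabs w) * cabs w ^+ 2 * (S ^+ 2 / J.+1%:R).
Proof.
move=> wt; have [td t0 tS] := wt => /subnKC <-; move: (N - J)%N => m.
set E := expR _ * _; have E0 : 0 <= E by rewrite mulr_ge0 ?expR_ge0 ?exprn_ge0 ?cabs_ge0.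
have S0 : 0 <= S by have := tS 0%N; rewrite big_ord0.
have SJ0 : 0 <= S / J.+1%:R by rewrite divr_ge0.
suff H : cabs (genus_approx t S (J + m) w - genus_approx t S J w) <=
    E * (S / J.+1%:R * (\sum_(j < J + m) t j - \sum_(j < J) t j)).
  apply: le_trans H _; rewrite ler_wpM2l // expr2 -[S * S / _]mulrA [S * (S / _)]mulrC.
  rewrite ler_wpM2l //.
  by rewrite lerBlDr; apply: le_trans (tS _) _; rewrite lerDl sumr_ge0.
elim: m => [|m IH]; first by rewrite addn0 !subrr !mulr0 cabs0.
rewrite addnS -(subrK (genus_approx t S (J + m) w) (genus_approx _ _ _.+1 _)) -addrA.
apply: le_trans (cabsD _ _) _.
apply: le_trans (lerD (genus_approx_step (J + m) w wt) IH) _.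
rewrite -/E -mulrDr ler_wpM2l // big_ord_recr /=.
have : t (J + m)%N ^+ 2 <= S / J.+1%:R * t (J + m)%N.
  rewrite expr2 ler_wpM2r //; apply: le_trans (weights_le J wt).
  by apply: decreasing_le => //; exact: leq_addr.
by move: (S / _) => a; lra.
Qed.

Lemma normal_form_weights (r : R) f alpha T t : normal_form r f alpha T t ->
  weights t (alpha + T).
Proof.
move=> [a0 td t01 tT _]; have t0 j : 0 <= t j by have /andP[] := t01 j.
split=> // n; apply: (@le_trans _ _ T); last by rewrite lerDr.
apply: (cvgr_to_ge tT); near=> m.
have /subnKC <- : (n <= m)%N by near: m; exact: nbhs_infty_ge.
by rewrite big_split_ord /= lerDl sumr_ge0.
Unshelve. all: by end_near. Qed.

(** Isolates the partial product of the normal form; the last exponential tends to 1 when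
    [S - alpha] is the sum of the weights. *)
Lemma genus_approxE t (S alpha : R) J w : genus_approx t S J w =
  cexp (rc alpha * w) * \prod_(j < J) (1 + rc (t j) * w)
    * cexp (rc (S - alpha - \sum_(j < J) t j) * w).
Proof.
rewrite /genus_approx (_ : S - _ = alpha + (S - alpha - \sum_(j < J) t j)); last by ring.
by rewrite rcD mulrDl cexpD mulrCA mulrA.
Qed.

Lemma cvg_cexp_remainder t (T : R) w : (fun N => \sum_(j < N) t j) @ \oo --> T ->
  cexp (rc (T - \sum_(j < N) t j) * w) @[N --> \oo] --> (1 : C).
Proof.
move=> tT; have e1 : (1 : C) = cexp (rc (T - T) * w) by rewrite subrr rc0 mul0r cexp0.
rewrite [X in _ --> X]e1; apply: cvg_cexp; apply: cvgM; last exact: cvg_cst.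
by apply: cvg_rc; apply: cvgB; [exact: cvg_cst|exact: tT].
Qed.

Lemma normal_form_approx (r : R) f alpha T t J w : normal_form r f alpha T t ->
  cabs (f (rc r * (1 + w)) - f (rc r) * genus_approx t (alpha + T) J w) <=
  cabs (f (rc r)) * (expR ((alpha + T) * cabs w) * cabs w ^+ 2
    * ((alpha + T) ^+ 2 / J.+1%:R)).
Proof.
move=> nf; set S := alpha + T; have wt := normal_form_weights nf; have [_ _ _ tT ff] := nf.
have cvg_approx : (fun N => f (rc r) * genus_approx t S N w) @ \oo --> f (rc r * (1 + w)).
  rewrite -[X in _ --> X]mulr1.
  rewrite (_ : (fun N => _) = fun N => f (rc r) * (cexp (rc alpha * w)
        * \prod_(j < N) (1 + rc (t j) * w)) * cexp (rc (T - \sum_(j < N) t j) * w)).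
    by apply: cvgM; [exact: ff|exact: cvg_cexp_remainder].
  apply/funext => N; rewrite (genus_approxE t S alpha) mulrA.
  by rewrite /S [alpha + T]addrC addrK.
apply: (@cabs_lim_le _ _ _ _ _ _ _ (cvgB cvg_approx (cvg_cst _))); near=> N.
rewrite -mulrBr cabsM ler_wpM2l ?cabs_ge0 //; apply: genus_approx_dist => //.
by near: N; exact: nbhs_infty_ge.
Unshelve. all: by end_near. Qed.

(** At w = 1, the product of e^alpha and of the 1 + t_j is at least (1 + alpha) (1 + sum t_j). *)
Lemma normal_form_growth (r : R) f alpha T t : normal_form r f alpha T t ->
  cabs (f (rc r)) * (alpha + T) <= cabs (f (rc r * (1 + 1))).
Proof.
move=> [a0 _ t01 tT ff]; have t0 j : 0 <= t j by have /andP[] := t01 j.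
have lhs : cabs (f (rc r)) * (alpha + \sum_(j < N) t j) @[N --> \oo] -->
    cabs (f (rc r)) * (alpha + T).
  by apply: cvgM; [exact: cvg_cst|apply: cvgD; [exact: cvg_cst|exact: tT]].
apply: (ler_cvg_to lhs (cvg_cabs_norm _ (ff 1))); apply: nearW => N.
rewrite cabsM ler_wpM2l ?cabs_ge0 // mulr1 cexp_rc.
rewrite (_ : \prod_(j < N) _ = rc (\prod_(j < N) (1 + t j))); last first.
  rewrite (rc_prod _ (fun j => 1 + t j)); apply: eq_bigr => j _.
  by rewrite mulr1 rcD rc1.
have prod_ge : 1 + \sum_(j < N) t j <= \prod_(j < N) (1 + t j).
  elim: N => [|N IH]; first by rewrite !big_ord0 addr0.
  rewrite !big_ord_recr /=; have := ler_wpM2r (addr_ge0 ler01 (t0 N)) IH.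
  have : 0 <= (\sum_(j < N) t j) * t N by rewrite mulr_ge0 ?sumr_ge0.
  by lra.
have s0 : 0 <= \sum_(j < N) t j by rewrite sumr_ge0.
rewrite -rcM cabs_rc; apply: le_trans (ler_norm _).
have := ler_pM _ _ (expR_ge1Dx alpha) prod_ge.
rewrite !addr_ge0 // => /(_ isT isT); apply: le_trans.
have : 0 <= alpha * \sum_(j < N) t j by rewrite mulr_ge0.
by lra.
Qed.

Lemma Laguerre_closed (fs : nat -> C -> C) f : (forall n, Laguerre (fs n)) ->
  (forall z, fs n z @[n --> \oo] --> f z) -> (exists z, f z != 0) -> Laguerre f.
Proof.
move=> lag cf [z0 fz0].
(* The summand 1 keeps [r] positive when [z0 = 0]; the maximum modulus inequality, passed to the
   limit, gives a nonzero value at [r]. *)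
pose r := cabs z0 + 1.
have r0 : 0 < r by rewrite ltr_wpDl ?cabs_ge0.
have fr0 : 0 < cabs (f (rc r)).
  apply: (@lt_le_trans _ _ (cabs (f z0))).
    by rewrite lt_neqAle eq_sym cabs_eq0 fz0 cabs_ge0.
  apply: (ler_cvg_to (cvg_cabs_norm _ (cf z0)) (cvg_cabs_norm _ (cf (rc r)))).
  by apply: nearW => n; apply: Laguerre_max_modulus => //; rewrite lerDl.
have /choice[al /choice[T /choice[t nf]]] : forall n, exists alpha T t,
    normal_form r (fs n) alpha T t by move=> n; exact: Laguerre_normal_form.
pose S n := al n + T n.
have wt n : weights (t n) (S n) := normal_form_weights (nf n).
have S0 n : 0 <= S n by have [_ _ /(_ 0%N)] := wt n; rewrite big_ord0.
have [B1 B1P] := cvg_ub (cvg_cabs_norm _ (cf (rc r * (1 + 1)))).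
(* In the quotient bounding [S n], the numerator is at most [B1] and the denominator eventually at
   least half of its limit. *)
pose B := B1 / (cabs (f (rc r)) / 2).
have SB : \forall n \near \oo, S n <= B.
  have : cabs (f (rc r)) / 2 < cabs (f (rc r)) by lra.
  move=> /(cvgr_ge _ (cvg_cabs_norm _ (cf (rc r)))); apply: filterS => n fn.
  rewrite ler_pdivlMr ?divr_gt0 // mulrC.
  apply: le_trans (ler_wpM2r (S0 n) fn) (le_trans (normal_form_growth (nf n)) (B1P n)).
(* Along one ultrafilter finer than [\oo], [S n] and all the [t n j] converge at once, in place of a
   diagonal subsequence. *)
have [U [ultraU ooU]] := @ultraFilterLemma nat \oo _.
have [Sl SlP] : exists l : R, S n @[n --> U] --> l.
  apply: (@ultra_cvg _ _ B) => //; apply: ooU; move: SB; apply: filterS => n.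
  by rewrite S0.
have /choice[tl tlP] : forall j, exists l : R, t n j @[n --> U] --> l.
  move=> j; apply: (@ultra_cvg _ _ 1) => //; apply: nearW => n.
  by have [_ _ /(_ j)] := nf n.
have sumP n : (fun m => \sum_(j < n) t m j) @ U --> \sum_(j < n) tl j.
  exact: (cvg_sum_ord (V := R^o) t tl).
have td j : tl j.+1 <= tl j.
  by apply: (ler_cvg_to (tlP j.+1) (tlP j)); apply: nearW => n; have [] := wt n.
have t01 j : 0 <= tl j <= 1.
  apply/andP; split.
    by apply: (cvgr_to_ge (tlP j)); apply: nearW => n; have [] := wt n.
  by apply: (cvgr_to_le (tlP j)); apply: nearW => n; have [_ _ /(_ j)/andP[]] := nf n.
have t0 j : 0 <= tl j by have /andP[] := t01 j.
have tS n : \sum_(j < n) tl j <= Sl.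
  by apply: (ler_cvg_to (sumP n) SlP); apply: nearW => m; have [] := wt m.
have [Tl [tT TS _]] := nonneg_sum_cvg t0 tS.
have cfU z : fs n z @[n --> U] --> f z by exact: cvg_trans (cvg_app _ ooU) (cf z).
(* [Sl] is the limit of the total weights and [Tl] the sum of the limit weights; the difference
   becomes the exponent. *)
apply: (@normal_form_Laguerre R r f (Sl - Tl) Tl tl r0).
split; [by rewrite subr_ge0|exact: td|exact: t01|exact: tT|].
move=> w; pose K := cabs (f (rc r)) * (expR (B * cabs w) * cabs w ^+ 2 * B ^+ 2).
have approx J : cabs (f (rc r * (1 + w)) - f (rc r) * genus_approx tl Sl J w) <= K / J.+1%:R.
  have gP : genus_approx (t n) (S n) J w @[n --> U] --> genus_approx tl Sl J w.
    apply: cvgM.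
      apply: (@cvg_prod_ord _ _ _ (fun n j => 1 + rc (t n j) * w)
        (fun j => 1 + rc (tl j) * w)) => j.
      apply: cvgD; first exact: cvg_cst.
      by apply: cvgM; [exact: cvg_rc (tlP j)|exact: cvg_cst].
    apply: cvg_cexp; apply: cvgM; last exact: cvg_cst.
    by apply: cvg_rc; exact: cvgB SlP (sumP J).
  have lhs : cabs (fs n (rc r * (1 + w)) - fs n (rc r) * genus_approx (t n) (S n) J w)
      @[n --> U] --> cabs (f (rc r * (1 + w)) - f (rc r) * genus_approx tl Sl J w).
    by apply: cvg_cabs_norm; apply: cvgB; [exact: cfU|apply: cvgM; [exact: cfU|exact: gP]].
  have rhs : cabs (fs n (rc r)) * (expR (B * cabs w) * cabs w ^+ 2 * B ^+ 2) / J.+1%:R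
      @[n --> U] --> K / J.+1%:R.
    apply: cvgM; last exact: cvg_cst.
    by apply: cvgM; [exact: cvg_cabs_norm (cfU (rc r))|exact: cvg_cst].
  apply: (ler_cvg_to lhs rhs); apply: ooU; move: SB; apply: filterS => n SnB.
  apply: le_trans (normal_form_approx J w (nf n)) _.
  have w2 : 0 <= cabs w ^+ 2 by rewrite exprn_ge0 ?cabs_ge0.
  rewrite -[X in _ <= X]mulrA; apply: ler_wpM2l; first exact: cabs_ge0.
  rewrite [X in X <= _]mulrA; apply: ler_wpM2r; first by rewrite invr_ge0.
  apply: ler_pM; [exact: mulr_ge0 (expR_ge0 _) w2|exact: exprn_ge0 (S0 n)| |].
    by apply: ler_wpM2r => //; rewrite ler_expR; apply: ler_wpM2r; rewrite ?cabs_ge0.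
  apply: lerXn2r (SnB); rewrite nnegrE; first exact: S0.
  exact: le_trans (S0 n) SnB.
have cvg_approx : (fun J => f (rc r) * genus_approx tl Sl J w) @ \oo --> f (rc r * (1 + w)).
  apply/cvg_cabs; apply: (@squeeze_cvgr _ _ _ _ (fun=> 0) (fun J => K / J.+1%:R)).
  - by apply: nearW => J; rewrite cabs_ge0 cabsB approx.
  - exact: cvg_cst.
  - rewrite -[X in _ --> X](mulr0 K); apply: cvgM; first exact: cvg_cst.
    exact: cvg_harmonic.
(* Division by the remainder exponential, which tends to 1, turns the approximant into the partial
   product of the normal form. *)
rewrite -[X in _ --> X]divr1.
rewrite (_ : (fun N => _) = fun N => (f (rc r) * genus_approx tl Sl N w)
    / cexp (rc (Tl - \sum_(j < N) tl j) * w)).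
  apply: cvgM; first exact: cvg_approx.
  by apply: cvgV; [exact: oner_neq0|exact: cvg_cexp_remainder tT].
apply/funext => N; rewrite (genus_approxE tl Sl (Sl - Tl)).
rewrite (_ : Sl - (Sl - Tl) = Tl); last by ring.
by rewrite [in RHS]mulrA mulfK // cexp_neq0.
Qed.

End Closure.

(** * The norms of A_a in terms of derivatives at 0 *)

Section NormA.
Variable R : realType.
Local Notation C := (CC R).
Implicit Types (g : C -> C) (b M : R).

Lemma normA_le b g M : 0 < b -> (forall k, cabs (derive1n k g 0) <= M * b ^+ k) ->
  (normA b g <= M%:E)%E.
Proof.
move=> b0 gM; apply: ge_ereal_sup => _ [k _ <-]; rewrite lee_fin mulrC.
by rewrite ler_pdivrMr ?exprn_gt0 //; exact: gM.
Qed.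

Lemma normA_ge0 b g : (0 <= normA b g)%E.
Proof.
apply: (@le_trans _ _ (b ^- 0 * cabs (derive1n 0 g 0))%:E).
  by rewrite lee_fin expr0 invr1 mul1r cabs_ge0.
by apply: ereal_sup_ubound; exists 0%N.
Qed.

Lemma normA_lty b g : 0 < b -> (normA b g < +oo)%E ->
  exists M, forall k, cabs (derive1n k g 0) <= M * b ^+ k.
Proof.
move=> b0 gb; have gfin : normA b g \is a fin_num by rewrite ge0_fin_numE ?normA_ge0.
exists (fine (normA b g)) => k; rewrite -ler_pdivrMr ?exprn_gt0 // -lee_fin fineK //.
by apply: ereal_sup_ubound; exists k => //; rewrite mulrC.
Qed.

(** Convergence to 0 in [\bar R] needs the norms to be eventually finite, which the bound with
    [e = 1] provides; the rest is real convergence. *)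
Lemma cvg_normA b (gs : nat -> C -> C) : 0 < b ->
  (forall e, 0 < e -> \forall n \near \oo,
     forall k, cabs (derive1n k (gs n) 0) <= e * b ^+ k) ->
  normA b (gs n) @[n --> \oo] --> 0%E.
Proof.
move=> b0 gse.
have small e : 0 < e -> \forall n \near \oo, (normA b (gs n) <= e%:E)%E.
  by move=> /gse; apply: filterS => n; exact: normA_le.
apply/fine_cvgP; split.
  move: (small 1 ltr01); apply: filterS => n n1.
  by rewrite ge0_fin_numE ?normA_ge0 // (le_lt_trans n1) // ltry.
apply/cvgr0Pnorm_le => e /small; apply: filterS => n ne.
have nfin : normA b (gs n) \is a fin_num.
  by rewrite ge0_fin_numE ?normA_ge0 // (le_lt_trans ne) // ltry.
by rewrite /= ger0_norm ?fine_ge0 ?normA_ge0 // -lee_fin fineK.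
Qed.

Lemma cvg_compact_pointwise (fs : nat -> C -> C) (f : C -> C) : cvg_compact fs f ->
  forall z, fs n z @[n --> \oo] --> f z.
Proof.
move=> cfs z; apply/cvg_cabs/cvgr0Pnorm_lt => e e0.
have := cfs _ (@compact_set1 _ z) e e0; apply: filterS => n /(_ z erefl).
by rewrite ger0_norm ?cabs_ge0.
Qed.

End NormA.

(** * Boundedness and convergence in A_a *)

Theorem theorem1p2 (R : realType) (a : R) (fs : nat -> CC R -> CC R)
    (f : CC R -> CC R) :
  0 <= a ->
  (forall n, Laguerre_a a (fs n)) ->
  cvg_compact fs f ->
  A_space a f ->
  (exists z, f z != 0) ->
  [/\ bounded_in_A a (range fs), cvg_in_A a fs f & Laguerre f].
Proof.
move=> a0 lagA /cvg_compact_pointwise cf [_ fA] fnz.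
have lag n : Laguerre (fs n) by have [] := lagA n.
have lf : Laguerre f := Laguerre_closed lag cf fnz.
have pos b : a < b -> 0 < b by exact: le_lt_trans.
have /choice[al /choice[p psP]] : forall n, exists (al : CC R) (p : nat -> R),
    logcv p /\ is_ps (fun k => al * rc (p k / k`!%:R)) (fs n).
  by move=> n; exact: Laguerre_ps (lag n).
have [al' [p' [_ psf]]] := Laguerre_ps lf.
pose cs n k : CC R := al n * rc (p n k / k`!%:R).
pose c k : CC R := al' * rc (p' k / k`!%:R).
have psn n : is_ps (cs n) (fs n) by have [] := psP n.
(* Nonnegativity bounds every coefficient of [fs n] by its modulus at 1, which converges and so is
   bounded in [n]. *)
have [M csM] := cvg_ub (cvg_cabs_norm _ (cf (rc 1))).
have coefM n k : cabs (cs n k) <= M.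
  have [[p0 _] _] := psP n; apply: le_trans (csM n).
  by have := Laguerre_coef_le k p0 (psn n) ler01; rewrite expr1n mulr1.
have cvgc := coef_cvg psn psf coefM cf.
pose es n k := cabs (derive1n k (fs n) 0); pose e k := cabs (derive1n k f 0).
have esE n k : es n k = k`!%:R * cabs (cs n k).
  by rewrite /es (ps_derive1n0 k (psn n)) cabsM -rc_nat cabs_rc normr_nat.
have eE k : e k = k`!%:R * cabs (c k).
  by rewrite /e (ps_derive1n0 k psf) cabsM -rc_nat cabs_rc normr_nat.
have esL n : logcv (es n).
  have [[p0 pL] _] := psP n.
  (* Taking moduli turns the complex constant into a nonnegative factor, which preserves
     log-concavity. *)
  have -> : es n = fun k => cabs (al n) * p n k.
    apply/funext => k; rewrite esE cabsM cabs_rc ger0_norm ?divr_ge0 //.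
    by rewrite mulrCA [_ * (p n k / _)]mulrC divfK // fact_neq0.
  split=> [k|i j ij]; first by rewrite mulr_ge0 ?cabs_ge0.
  by rewrite mulrACA [X in _ <= X]mulrACA ler_wpM2l ?mulr_ge0 ?cabs_ge0 // pL.
have cvge k : es n k @[n --> \oo] --> e k.
  rewrite eE; under eq_fun do rewrite esE.
  by apply: cvgM; [exact: cvg_cst|exact: cvg_cabs_norm (cvgc k)].
(* If all derivatives at 0 vanished, the power series would force [f] to vanish identically. *)
have [l el] : exists l, 0 < e l.
  apply: contrapT => nex; have [z /eqP] := fnz; apply.
  apply: (limC_unique (proj2 psf z)).
  rewrite (_ : (fun N => _) = fun=> 0); first exact: cvg_cst.
  apply/funext => N; rewrite big1 // => k _.
  suff -> : al' * rc (p' k / k`!%:R) = 0 by rewrite mul0r.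
  apply/eqP; rewrite -cabs_eq0 eq_le cabs_ge0 andbT leNgt; apply/negP => ck.
  by apply: nex; exists k; rewrite eE mulr_gt0 // ltr0n fact_gt0.
have eM b : a < b -> exists M, forall k, e k <= M * b ^+ k.
  by move=> ab; apply: normA_lty (fA _ ab); exact: pos.
have esM n b : a < b -> exists M, forall k, es n k <= M * b ^+ k.
  by move=> ab; have [_ [_ /(_ _ ab)]] := lagA n; apply: normA_lty; exact: pos.
have unif := logcv_uniform_bound a0 esL cvge el eM esM.
split => //.
  move=> b ab; have [B BP] := unif b ab.
  by exists B => _ [n _ <-]; apply: normA_le (pos _ ab) (BP n).
move=> b ab; have b0 := pos _ ab; apply: (cvg_normA b0) => d d0.
(* The bound at the smaller radius [b'] beats [d * b ^+ k] for large [k], uniformly in [n]; the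
   finitely many other [k] are handled by convergence of the coefficients. *)
pose b' := (a + b) / 2.
have ab' : a < b' by rewrite /b'; lra.
have b'b : b' < b by rewrite /b'; lra.
have [B BP] := unif b' ab'.
have eB k : e k <= B * b' ^+ k by apply: (cvgr_to_le (cvge k)); apply: nearW => n; exact: BP.
have diffE n k : cabs (derive1n k (fun z => fs n z - f z) 0) = k`!%:R * cabs (cs n k - c k).
  by rewrite (ps_derive1n0 k (ps_sub (psn n) psf)) cabsM -rc_nat cabs_rc normr_nat.
have diff_le n k : cabs (derive1n k (fun z => fs n z - f z) 0) <= 2 * B * b' ^+ k.
  rewrite diffE; apply: (@le_trans _ _ (es n k + e k)).
    rewrite esE eE -mulrDr ler_wpM2l //.
    by apply: le_trans (cabsD _ _) _; rewrite cabsN.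
  by have := BP n k; have := eB k; lra.
have [K _ KP] : \forall k \near \oo, 2 * B * (b' / b) ^+ k <= d.
  have := cvg_ratio_exp0 (2 * B) (le_trans a0 (ltW ab')) b'b.
  by move=> /(cvgr_le _)/(_ d d0).
have small : \forall n \near \oo, forall k : 'I_K,
    cabs (derive1n k (fun z => fs n z - f z) 0) <= d * b ^+ k.
  apply: filter_forall => k; under eq_near do rewrite diffE.
  have bk : 0 < d * b ^+ k by rewrite mulr_gt0 // exprn_gt0.
  have : k`!%:R * cabs (cs n k - c k) @[n --> \oo] --> (0 : R).
    rewrite -[X in _ --> X](mulr0 (k`!%:R)); apply: cvgM; first exact: cvg_cst.
    by apply/cvg_cabs; exact: cvgc.
  by move=> /(cvgr_le _)/(_ _ bk).
move: small; apply: filterS => n small k.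
case: (ltnP k K) => kK; first exact: (small (Ordinal kK)).
apply: le_trans (diff_le n k) _.
by have := KP k kK; rewrite /= exprMn exprVn mulrA ler_pdivrMr ?exprn_gt0.
Qed.
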